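(* Let $G=(V,E)$ be a finite graph with $V=\{1,\dots,n\}$ and maximum degree $\Delta=\Delta(G)\ge 3$, let $\beta\in\mathbb R$, $v\in\mathbb R^n$, and let $\nu$ be the probability measure on $\{-1,1\}^n$ given by $$\nu(x)\propto\exp\Bigl(\langle x,v\rangle+\beta\sum_{(i,j)\in E}\mathbf 1_{\{x_i=x_j\}}\Bigr).$$ Suppose that, for some $\delta\in(0,1)$, $$\exp(|\beta|)<\frac{\Delta-\delta}{\Delta-2+\delta}.$$ Then $$\rho_{\mathrm{LS}}\bigl(P^{\mathrm{GD}}(\nu)\bigr)\ge\frac{\exp(-8/\delta)}{n}.$$ Consequently, for fixed $\delta$ and $\varepsilon\in(0,1)$, the mixing time $t_{\mathrm{mix}}(P^{\mathrm{GD}}(\nu),\varepsilon)$ of the Glauber dynamics is $O(n\log n)$, with an implied constant depending only on $\delta$ and $\varepsilon$.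
   Context: Glauber dynamics: for a probability measure $\nu$ on $\{-1,1\}^n$, $P^{\mathrm{GD}}(\nu)$ is the Markov kernel on the support of $\nu$ with $P^{\mathrm{GD}}_{x\to y}(\nu)=\frac1n\frac{\nu(y)}{\nu(x)+\nu(y)}$ if $x,y$ differ in exactly one coordinate, $P^{\mathrm{GD}}_{x\to x}(\nu)=\frac1n\sum_{i=1}^n\frac{\nu(x)}{\nu(x)+\nu(x\oplus e_i)}$ where $x\oplus e_i$ is $x$ with coordinate $i$ flipped, and $0$ otherwise. Modified log-Sobolev (MLSI) coefficient of a reversible kernel $P$ with stationary measure $\nu$: $\rho_{\mathrm{LS}}(P)=1-\sup_{f:\Omega\to[0,\infty)}\frac{\mathrm{Ent}_\nu[Pf]}{\mathrm{Ent}_\nu[f]}$, supremum over $f$ with $\mathrm{Ent}_\nu[f]>0$, where $\mathrm{Ent}_\nu[f]=\int f\log f\,d\nu-\int f\,d\nu\,\log\int f\,d\nu$. Mixing time: $t_{\mathrm{mix}}(P,\varepsilon)=\max_{x}\min\{t>0:\ |P^t[\delta_x](A)-\nu(A)|\le\varepsilon\ \forall A\}$, $t$ ranging over positive integers and $P^t[\delta_x]$ being the law after $t$ steps from $x$. *)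

(* Defs.v *)
From HB Require Import structures.
From mathcomp Require Import all_boot all_order all_algebra.
From mathcomp Require Import all_classical all_reals all_analysis.
Set Implicit Arguments.
Unset Strict Implicit.
Unset Printing Implicit Defensive.
Import Order.TTheory GRing.Theory Num.Theory.
Local Open Scope classical_set_scope.
Local Open Scope ring_scope.

(** Measures and Markov chains on a finite state space [T]: a measure is given
    by its mass function [T -> R], a Markov kernel by its transition
    probabilities [P x y], from [x] to [y]. *)

Notation supp nu := {x | 0 < nu x}.

Definition on_supp (R : realType) (T : finType) (nu : T -> R) : supp nu -> R :=
  fun x => nu (val x).
Arguments on_supp {R T} nu x.

Section FiniteChains.
Variables (R : realType) (T : finType).
Implicit Types (nu mu f : T -> R) (P : T -> T -> R).

Definition expect nu f : R := \sum_x nu x * f x.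

(** Since [ln 0 = 0], the convention 0 log 0 = 0 holds here. *)
Definition Ent nu f : R :=
  expect nu (fun x => f x * ln (f x)) - expect nu f * ln (expect nu f).

Definition kact P f : T -> R := fun x => \sum_y P x y * f y.

(** The supremum is taken in the extended reals, so that it is meaningful
    without knowing that the set of ratios is nonempty and bounded. *)
Definition rhoLS nu P : \bar R :=
  (1 - ereal_sup [set (Ent nu (kact P f) / Ent nu f)%:E
                  | f in [set f : T -> R | (forall x, 0 <= f x)%R /\
                                           (0 < Ent nu f)%R]])%E.

Definition kpush P mu : T -> R := fun y => \sum_x mu x * P x y.

Definition pmass (x : T) : T -> R := fun y => (y == x)%:R.

Definition law P (t : nat) (x : T) : T -> R := iter t (kpush P) (pmass x).

Definition mixed nu P (eps : R) (x : T) (t : nat) : Prop :=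
  forall A : {set T},
    `| \sum_(y in A) law P t x y - \sum_(y in A) nu y | <= eps.

(** A set of natural numbers has its infimum in [\bar R] as a minimum, unless
    it is empty, in which case the mixing time is [+oo]. *)
Definition tmix_from nu P (eps : R) (x : T) : \bar R :=
  ereal_inf [set (t%:R : R)%:E
             | t in [set t : nat | (0 < t)%N /\ mixed nu P eps x t]].

Definition tmix nu P (eps : R) : \bar R :=
  \big[maxe/-oo%E]_(x : T) tmix_from nu P eps x.

End FiniteChains.

(** The cube {-1,1}^n is encoded by boolean vectors, [true] standing for the
    spin +1 and [false] for the spin -1. *)
Notation cube n := {ffun 'I_n -> bool}.

Definition spin (R : realType) (b : bool) : R := if b then 1 else -1.

Definition flip (n : nat) (x : cube n) (i : 'I_n) : cube n :=
  [ffun j => if j == i then ~~ x j else x j].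

Definition glauber (R : realType) (n : nat) (nu : cube n -> R)
    (x y : supp nu) : R :=
  if #|[set i | val x i != val y i]%SET| == 1%N then
    n%:R^-1 * (nu (val y) / (nu (val x) + nu (val y)))
  else if x == y then
    n%:R^-1 * \sum_(i < n) nu (val x) / (nu (val x) + nu (flip (val x) i))
  else 0.
Arguments glauber {R n} nu x y.

(** A simple graph on the vertex set ['I_n] is given by its adjacency relation. *)
Definition simple_graph (n : nat) (e : rel 'I_n) : Prop :=
  symmetric e /\ irreflexive e.

Definition max_degree (n : nat) (e : rel 'I_n) : nat :=
  \max_(i < n) #|[set j | e i j]%SET|.

(** The condition [i < j] makes each undirected edge count exactly once. *)
Definition ising_weight (R : realType) (n : nat) (e : rel 'I_n) (beta : R)
    (v : 'rV[R]_n) (x : cube n) : R :=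
  expR (\sum_(i < n) spin R (x i) * v ord0 i
        + beta * \sum_(i < n) \sum_(j < n | (i < j)%N && e i j)
                   (x i == x j)%:R).

Definition ising (R : realType) (n : nat) (e : rel 'I_n) (beta : R)
    (v : 'rV[R]_n) (x : cube n) : R :=
  ising_weight e beta v x / \sum_(y : cube n) ising_weight e beta v y.

(* Main.v *)
Require Import Defs.
From HB Require Import structures.
From mathcomp Require Import all_boot all_order all_algebra.
From mathcomp Require Import all_classical all_reals all_analysis.
From mathcomp Require Import ring lra.
Import Order.TTheory GRing.Theory Num.Theory.
Local Open Scope ring_scope.
Set Implicit Arguments.
Unset Strict Implicit.
Unset Printing Implicit Defensive.

(** The modified log-Sobolev bound follows from approximate tensorisation of
    entropy ([approximate_tensorization]): the entropy of [f] is at most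
    [expR (8 / delta)] times the sum over the vertices [i] of the mean entropy of
    [f] in the spin of [i] alone. Indeed a step of the dynamics averages over [i]
    the operators that resample spin [i]; each removes the local entropy at [i],
    and entropy is convex ([entropy_contraction]).

    For a product measure tensorisation holds with constant 1 ([tensorization]).
    The interaction is removed in many small rounds ([peeling]). A round
    observes, for every edge, a weak noisy sign of [x_i + x_j], or of [x_i - x_j]
    when [beta] is negative. Such a sum of two spins takes three values, so that
    conditioning on the signs leaves an Ising measure on the same graph, with
    slightly weaker interaction and random external fields ([gibbs_signal]). Local
    entropies do not increase in such a decomposition ([locEnt_superadditive]),
    hence only the part of the entropy that is carried by the law of the signs has
    to be controlled. That part is a divergence; to leading order it is
    proportional to the squared displacement of the mean spins caused by the density
    [f] ([wEnt_signals_le]), and this is at most a constant times the entropy of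
    [f] itself, because the covariance matrices of all the Ising measures at
    hand are bounded ([mean_displacement_le]). Each round thus keeps all but a
    fraction of order [1 / N] of the entropy; after [N] rounds the measure is a
    product, and at least the fraction [expR (- 8 / delta)] is left.

    The covariance bound comes from influences ([influence_row_le]). Freezing a
    vertex at either value gives Ising measures on the remaining graph whose fields
    differ only at its neighbours, and this change of the field of one neighbour
    shifts the law of its spin by at most [tanh (|beta| / 2)]. As each neighbour
    has lost an edge, the total influence of a vertex is bounded by a geometric
    series of ratio [(D - 1) * tanh (|beta| / 2) <= 1 - delta], where [D] is the
    maximum degree, for all external fields.

    For the mixing time, entropy contraction alone does not suffice from a point,
    since the fields are arbitrary and a point may have arbitrarily small measure. However the fields are felt exactly at each update, and the neighbours
    change the conditional law of a spin by a bounded factor only. Hence, once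
    every vertex has been updated, which takes about [n * ln n] steps, the law
    has a density of at most [expR (6 * n)] ([updated_le], [ising_ge_free]), thus
    an entropy that is at most linear in [n], and contraction and Pinsker's
    inequality finish in [O(n * ln n)] further steps ([law_dist_le]). *)

(** * Relative entropy on finite sets *)

Section RelativeEntropy.
Variables (R : realType) (T : finType).
Implicit Types (a b mu nu : T -> R).

(** The Kullback-Leibler divergence when [mu] and [nu] are probability vectors;
    the log-sum inequality uses it for other vectors as well. *)
Definition KL mu nu : R := \sum_x mu x * (ln (mu x) - ln (nu x)).

Lemma ln_tangent (a y : R) :
  0 <= a -> 0 <= y -> (y = 0 -> a = 0) -> a - y <= a * (ln a - ln y).
Proof.
rewrite le_eqVlt => /predU1P[<- y0 _|a0].
  by rewrite sub0r mul0r oppr_le0.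
rewrite le_eqVlt => /predU1P[<- /(_ erefl) a_eq0|y0 _].
  by rewrite a_eq0 ltxx in a0.
have ya0 : 0 < y / a by rewrite divr_gt0.
have := @le_ln1Dx R (y / a - 1).
rewrite addrCA subrr addr0 ln_div ?posrE // => /(_ _).
rewrite ltrBrDr addNr => /(_ ya0) h.
have : a * (ln y - ln a) <= a * (y / a - 1) by rewrite ler_pM2l.
rewrite [_ * (y / a - 1)]mulrBr mulr1 [a * (y / a)]mulrC divfK ?gt_eqF // => {}h.
by rewrite -[_ - ln y]opprB mulrN lerNr opprB.
Qed.

(** Log-sum inequality: sum the tangent inequality at [a i] against
    [b i * (A / B)], where [A] and [B] are the two totals. *)
Lemma log_sum a b :
    (forall i, 0 <= a i) -> (forall i, 0 <= b i) ->
    (forall i, b i = 0 -> a i = 0) ->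
  (\sum_i a i) * (ln (\sum_i a i) - ln (\sum_i b i)) <= KL a b.
Proof.
move=> a0 b0 ba; rewrite /KL.
set A := \sum_i a i; set B := \sum_i b i.
have [A_eq0|A_neq0] := eqVneq A 0.
  rewrite A_eq0 mul0r big1 // => i _.
  suff -> : a i = 0 by rewrite mul0r.
  exact: (psumr_eq0P (fun j _ => a0 j) A_eq0).
have A_gt0 : 0 < A by rewrite lt_def A_neq0 sumr_ge0.
have B_gt0 : 0 < B.
  rewrite lt_def sumr_ge0 // andbT; apply: contra A_neq0 => /eqP B_eq0.
  by rewrite /A big1 // => i _; exact/ba/(psumr_eq0P (fun j _ => b0 j) B_eq0).
have r0 : 0 < A / B by rewrite divr_gt0.
have : \sum_i (a i - b i * (A / B)) <=
       \sum_i a i * (ln (a i) - ln (b i) - ln (A / B)).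
  apply: ler_sum => i _.
  have h : b i * (A / B) = 0 -> a i = 0.
    by move/eqP; rewrite mulf_eq0 (gt_eqF r0) orbF => /eqP; exact: ba.
  apply: (le_trans (ln_tangent (a0 i) _ h)); first by rewrite mulr_ge0 // ltW.
  have [bi0|bi_neq0] := eqVneq (b i) 0; first by rewrite (ba _ bi0) !mul0r.
  rewrite lnM ?posrE //; last by rewrite lt_def bi_neq0 b0.
  by rewrite opprD addrA.
rewrite sumrB -mulr_suml -/A -/B mulrCA divff ?gt_eqF // mulr1 subrr.
under [X in _ <= X]eq_bigr do rewrite mulrBr.
by rewrite sumrB -mulr_suml -/A ln_div ?posrE // subr_ge0.
Qed.

Lemma cauchy_schwarz_sum a b :
  (\sum_x a x * b x) ^+ 2 <= (\sum_x a x ^+ 2) * (\sum_x b x ^+ 2).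
Proof.
set A := \sum_x a x ^+ 2; set B := \sum_x b x ^+ 2; set C := \sum_x _ * _.
have : 0 <= \sum_x \sum_y (a x * b y - a y * b x) ^+ 2.
  by apply: sumr_ge0 => x _; apply: sumr_ge0 => y _; exact: sqr_ge0.
suff -> : \sum_x \sum_y (a x * b y - a y * b x) ^+ 2 = 2 * (A * B - C ^+ 2).
  by rewrite pmulr_rge0 // subr_ge0.
have -> : 2 * (A * B - C ^+ 2) = A * B + B * A - 2 * (C * C) by ring.
rewrite /A /B /C !big_distrlr /= mulr_sumr -big_split -sumrB /=.
apply: eq_bigr => x _; rewrite mulr_sumr -big_split -sumrB /=.
by apply: eq_bigr => y _; ring.
Qed.

(** A form of Pinsker's inequality whose constant is twice the optimal one.
    The tangent inequality at square roots bounds the squared Hellinger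
    distance by the divergence; Cauchy-Schwarz does the rest. *)
Lemma pinsker mu nu :
  (forall x, 0 <= mu x) -> (forall x, 0 < nu x) ->
  \sum_x mu x = 1 -> \sum_x nu x = 1 ->
  (\sum_x `|mu x - nu x|) ^+ 2 <= 4 * KL mu nu.
Proof.
move=> mu0 nu0 mu1 nu1.
pose s x := Num.sqrt (mu x); pose r x := Num.sqrt (nu x).
have sE x : mu x = s x ^+ 2 by rewrite sqr_sqrtr.
have rE x : nu x = r x ^+ 2 by rewrite sqr_sqrtr // ltW.
have s0 x : 0 <= s x by exact: sqrtr_ge0.
have r0 x : 0 < r x by rewrite sqrtr_gt0.
have lnsq (z : R) : 0 <= z -> ln (z ^+ 2) = 2 * ln z.
  rewrite le_eqVlt => /predU1P[<-|z0]; first by rewrite expr0n /= ln0 ?mulr0.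
  by rewrite lnXn // mulr_natl.
have hell : \sum_x `|s x - r x| ^+ 2 <= KL mu nu.
  have -> : KL mu nu = \sum_x (mu x * (ln (mu x) - ln (nu x)) - mu x + nu x).
    by rewrite big_split /= sumrB mu1 nu1 addrNK.
  apply: ler_sum => x _; rewrite sE rE !lnsq //; last exact: ltW.
  have h : s x - r x <= s x * (ln (s x) - ln (r x)).
    apply: ln_tangent => //; first exact: ltW.
    by move=> rx0; have := r0 x; rewrite rx0 ltxx.
  have := ler_wpM2l (mulr_ge0 (ler0n R 2) (s0 x)) h.
  rewrite real_normK ?num_real // -subr_ge0 => {}h; rewrite -subr_ge0.
  apply: le_trans h _; rewrite le_eqVlt; apply/orP; left; apply/eqP; ring.
have sr : \sum_x (s x + r x) ^+ 2 <= 4.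
  have : \sum_x (s x + r x) ^+ 2 <= \sum_x 2 * (mu x + nu x).
    apply: ler_sum => x _; rewrite sE rE -subr_ge0.
    have -> : 2 * (s x ^+ 2 + r x ^+ 2) - (s x + r x) ^+ 2 = (s x - r x) ^+ 2 by ring.
    exact: sqr_ge0.
  by move/le_trans; apply; rewrite -mulr_sumr big_split /= mu1 nu1; lra.
have -> : \sum_x `|mu x - nu x| = \sum_x `|s x - r x| * (s x + r x).
  apply: eq_bigr => x _; rewrite sE rE subr_sqr normrM; congr (_ * _).
  by rewrite ger0_norm // addr_ge0 // ltW.
apply: le_trans (cauchy_schwarz_sum _ _) _.
rewrite mulrC; apply: ler_pM => //; apply: sumr_ge0 => x _; exact: sqr_ge0.
Qed.

End RelativeEntropy.

(** * Entropy with respect to a weight *)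

Section WeightedEntropy.
Variables (R : realType) (T : finType).
Implicit Types (w f g : T -> R).

(** The entropy of [f] with respect to a weight [w] that need not be
    normalised. It is homogeneous in [w], so that a decomposition of a measure
    into a mixture is a mere sum of weights. *)
Definition wEnt w f : R :=
  \sum_x w x * f x * ln (f x)
  - (\sum_x w x * f x) * (ln (\sum_x w x * f x) - ln (\sum_x w x)).

Lemma wEnt_scale (k : R) w f : 0 < k -> (forall x, 0 < w x) ->
  (forall x, 0 <= f x) -> wEnt (fun x => k * w x) f = k * wEnt w f.
Proof.
move=> k0 w0 f0; rewrite /wEnt.
have eS : \sum_x k * w x * f x = k * \sum_x w x * f x.
  by rewrite mulr_sumr; apply: eq_bigr => x _; rewrite mulrA.
have eL : \sum_x k * w x * f x * ln (f x) = k * \sum_x w x * f x * ln (f x).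
  by rewrite mulr_sumr; apply: eq_bigr => x _; rewrite !mulrA.
rewrite eS eL -mulr_sumr [RHS]mulrBr [k * (_ * (_ - _))]mulrA.
have [->|S_neq0] := eqVneq (\sum_x w x * f x) 0; first by rewrite !(mulr0, mul0r).
have S0 : 0 < \sum_x w x * f x.
  by rewrite lt_def S_neq0 sumr_ge0 // => x _; rewrite mulr_ge0 // ltW.
have [W|W_neq0] := eqVneq (\sum_x w x) 0.
  case/eqP: S_neq0; apply: big1 => x _.
  by rewrite (psumr_eq0P (fun j _ => ltW (w0 j)) W) // mul0r.
have W0 : 0 < \sum_x w x by rewrite lt_def W_neq0 sumr_ge0 // => x _; exact: ltW.
by rewrite !lnM ?posrE // opprD addrACA subrr add0r.
Qed.

(** Up to the factor of total mass, entropy is the divergence from the normalised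
    weight of its reweighting by [f]. *)
Lemma wEntE_KL w f : (forall x, 0 < w x) -> (forall x, 0 <= f x) ->
    0 < \sum_x w x * f x ->
  wEnt w f = (\sum_x w x * f x) *
    KL (fun x => w x * f x / \sum_x w x * f x) (fun x => w x / \sum_x w x).
Proof.
move=> w0 f0; set S := \sum_x w x * f x => S0; set W := \sum_x w x.
have W0 : 0 < W.
  rewrite lt_def sumr_ge0 ?andbT => [|x _]; last exact: ltW.
  apply: contraTneq S0 => W0; rewrite /S big1 ?ltxx // => x _.
  by rewrite (psumr_eq0P (fun j _ => ltW (w0 j)) W0) // mul0r.
rewrite /wEnt /KL -/S -/W mulr_sumr.
have -> : S * (ln S - ln W) = \sum_x w x * f x * (ln S - ln W) by rewrite -mulr_suml.
rewrite -sumrB; apply: eq_bigr => x _.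
have -> (a L : R) : S * (a / S * L) = a * L by field; rewrite gt_eqF.
have [->|fx] := eqVneq (f x) 0; first by rewrite !(mulr0, mul0r) subrr.
have fx0 : 0 < f x by rewrite lt_def fx f0.
rewrite !ln_div ?lnM ?posrE //; last by rewrite mulr_gt0.
by ring.
Qed.

Lemma wEnt_ge0 w f :
  (forall x, 0 < w x) -> (forall x, 0 <= f x) -> 0 <= wEnt w f.
Proof.
move=> w0 f0; rewrite /wEnt subr_ge0.
have := @log_sum R T (fun x => w x * f x) w.
have -> : KL (fun x => w x * f x) w = \sum_x w x * f x * ln (f x).
  apply: eq_bigr => x _.
  have [->|fx] := eqVneq (f x) 0; first by rewrite !(mulr0, mul0r).
  by rewrite lnM ?posrE ?lt_def ?fx ?f0 ?(gt_eqF (w0 x)) ?ltW //; ring.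
apply=> [x|x|x wx]; first by rewrite mulr_ge0 // ltW.
  exact: ltW.
by have := w0 x; rewrite wx ltxx.
Qed.

Lemma wEnt_null w f : (forall x, 0 < w x) -> (forall x, 0 <= f x) ->
  \sum_x w x * f x = 0 -> wEnt w f = 0.
Proof.
move=> w0 f0 S0; rewrite /wEnt S0 mul0r subr0 big1 // => x _.
by rewrite (psumr_eq0P (fun j _ => mulr_ge0 (ltW (w0 j)) (f0 j)) S0) // mul0r.
Qed.

(** Jensen's inequality for [t * ln t], pointwise by the log-sum inequality. *)
Lemma wEnt_average (n : nat) w (f : 'I_n -> T -> R) (m : R) :
    (0 < n)%N -> (forall x, 0 < w x) -> (forall i x, 0 <= f i x) ->
    (forall i, \sum_x w x * f i x = m) ->
  wEnt w (fun x => n%:R^-1 * \sum_i f i x) <= n%:R^-1 * \sum_i wEnt w (f i).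
Proof.
move=> n0 w0 f0 fm; have nR : 0 < n%:R :> R by rewrite ltr0n.
have favg : \sum_x w x * (n%:R^-1 * \sum_i f i x) = m.
  under eq_bigr do rewrite mulrCA mulr_sumr.
  rewrite -mulr_sumr exchange_big /=.
  under eq_bigr do rewrite fm.
  by rewrite sumr_const card_ord -[m *+ n]mulr_natl mulrA mulVf ?mul1r // gt_eqF.
rewrite /wEnt favg.
under [in X in _ <= X]eq_bigr do rewrite fm.
rewrite sumrB [X in _ <= X]mulrBr sumr_const card_ord.
rewrite -[X in _ <= _ - _ * X]mulr_natl [X in _ <= _ - X]mulrA mulVf ?gt_eqF // mul1r.
rewrite lerD2r exchange_big mulr_sumr; apply: ler_sum => x _ /=.
have -> : \sum_i w x * f i x * ln (f i x) = w x * \sum_i f i x * ln (f i x).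
  by rewrite mulr_sumr; apply: eq_bigr => i _; rewrite mulrA.
rewrite -mulrA [X in _ <= X]mulrCA ler_pM2l //.
have := @log_sum R 'I_n (fun i => f i x) (fun=> 1).
have -> : KL (f^~ x) (fun=> 1) = \sum_i f i x * ln (f i x).
  by apply: eq_bigr => i _; rewrite ln1 subr0.
rewrite sumr_const card_ord => /(_ _ _ _) h.
set S := \sum_i f i x in h *.
have {}h : S * (ln S - ln n%:R) <= \sum_i f i x * ln (f i x).
  by apply: h => // i h1; have := oner_neq0 R; rewrite h1 eqxx.
rewrite -mulrA ler_pM2l ?invr_gt0 //.
have [S0|S_neq0] := eqVneq S 0; first by move: h; rewrite S0 !mul0r.
have S0 : 0 < S by rewrite lt_def S_neq0 sumr_ge0.
by rewrite [_^-1 * S]mulrC ln_div ?posrE.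
Qed.

End WeightedEntropy.

(** * Single-site resampling on the cube *)

Section Flip.
Variable n : nat.
Implicit Types (x y : cube n) (i j : 'I_n).

Lemma flipE x i j : flip x i j = if j == i then ~~ x j else x j.
Proof. by rewrite ffunE. Qed.

Lemma flipK i : involutive (fun x : cube n => flip x i).
Proof. by move=> x; apply/ffunP => j; rewrite !ffunE; case: (j == i); rewrite ?negbK. Qed.

Lemma flipC x i j : flip (flip x i) j = flip (flip x j) i.
Proof. by apply/ffunP => k; rewrite !ffunE; case: (k == i); case: (k == j). Qed.

Lemma sum_flip (V : nmodType) (F : cube n -> V) i :
  \sum_x F (flip x i) = \sum_x F x.
Proof. by rewrite [RHS](reindex_inj (inv_inj (flipK i))). Qed.

Lemma flip_invariant_const (V : Type) (g : cube n -> V) :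
  (forall i x, g (flip x i) = g x) -> forall x y, g x = g y.
Proof.
move=> gi x y.
have [k] := ubnP #|[set i | x i != y i]|.
elim: k x => // k IH x; rewrite ltnS => xk.
have [D0|[i]] := set_0Vmem [set i | x i != y i].
  congr g; apply/ffunP => i; apply/eqP; have := finset.in_set0 i.
  by rewrite -D0 inE => /negbFE.
rewrite inE => xi; rewrite -(gi i x); apply: IH; apply: leq_trans xk.
apply: proper_card; apply/properP; split.
  apply/fintype.subsetP => j; rewrite !inE flipE; case: (eqVneq j i) => [->|//].
  by move: xi; case: (x i); case: (y i).
by exists i; rewrite !inE ?flipE ?eqxx //; move: xi; case: (x i); case: (y i).
Qed.

End Flip.

Section LocalEntropy.
Variables (R : realType) (n : nat).
Implicit Types (w f g : cube n -> R) (x : cube n) (i j : 'I_n).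

(** Conditional expectation of [f] given all the coordinates but [i]. *)
Definition resample w i f x : R :=
  (w x * f x + w (flip x i) * f (flip x i)) / (w x + w (flip x i)).

(** The [w]-average of the entropy of [f] as a function of coordinate [i] alone,
    given the other coordinates. *)
Definition locEnt w i f : R :=
  \sum_x w x * f x * (ln (f x) - ln (resample w i f x)).

Lemma resample_flip w i f x : resample w i f (flip x i) = resample w i f x.
Proof. by rewrite /resample flipK addrC [w (flip x i) + _]addrC. Qed.

Lemma resample_id w i f : (forall x, 0 < w x) ->
  (forall x, f (flip x i) = f x) -> forall x, resample w i f x = f x.
Proof.
move=> w0 fi x; rewrite /resample fi -mulrDl mulrAC divff ?mul1r //.
by rewrite gt_eqF // addr_gt0.
Qed.

Lemma resample_ge0 w i f : (forall x, 0 < w x) -> (forall x, 0 <= f x) ->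
  forall x, 0 <= resample w i f x.
Proof.
move=> w0 f0 x; rewrite divr_ge0 ?addr_ge0 ?mulr_ge0 //; exact: ltW.
Qed.

Lemma resample_gt0 w i f x : (forall x, 0 < w x) -> (forall x, 0 <= f x) ->
  0 < f x -> 0 < resample w i f x.
Proof.
move=> w0 f0 fx; apply: divr_gt0; last exact: addr_gt0.
by rewrite ltr_pwDl ?mulr_gt0 // mulr_ge0 // ltW.
Qed.

Lemma sum_flip_half (F : cube n -> R) i :
  \sum_x F x = 2^-1 * \sum_x (F x + F (flip x i)).
Proof. by rewrite big_split /= sum_flip; field. Qed.

Lemma sum_resample w i f g : (forall x, 0 < w x) ->
    (forall x, g (flip x i) = g x) ->
  \sum_x w x * resample w i f x * g x = \sum_x w x * f x * g x.
Proof.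
move=> w0 gi; rewrite (sum_flip_half _ i) [RHS](sum_flip_half _ i).
congr (_ * _); apply: eq_bigr => x _; rewrite resample_flip !gi -!mulrDl.
by congr (_ * _); rewrite mulrC divfK // gt_eqF // addr_gt0.
Qed.

Lemma sum_resample1 w i f : (forall x, 0 < w x) ->
  \sum_x w x * resample w i f x = \sum_x w x * f x.
Proof.
move=> w0; have := @sum_resample w i f (fun=> 1) w0 (fun=> erefl).
by under eq_bigr do rewrite mulr1; under [in RHS]eq_bigr do rewrite mulr1.
Qed.

Lemma locEntE w i f : (forall x, 0 < w x) ->
  locEnt w i f = wEnt w f - wEnt w (resample w i f).
Proof.
move=> w0; rewrite /wEnt sum_resample1 // opprB addrA subrK /locEnt.
rewrite (@sum_resample w i f (fun x => ln (resample w i f x)) w0) => [|x]; last first.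
  by rewrite resample_flip.
by rewrite -sumrB; apply: eq_bigr => x _; rewrite mulrBr.
Qed.

(** On each pair of points that differ at [i], the entropy of [f] is a concave and
    homogeneous function of the two weights, by the log-sum inequality. This is
    what keeps local entropies under control when a weight is decomposed. *)
Lemma locEnt_superadditive (K : finType) (W : K -> cube n -> R) i f :
    (forall k x, 0 < W k x) -> (forall x, 0 <= f x) ->
  \sum_k locEnt (W k) i f <= locEnt (fun x => \sum_k W k x) i f.
Proof.
move=> W0 f0.
have mass w x : (forall x, 0 < w x) ->
    w x * f x * (ln (f x) - ln (resample w i f x)) +
    w (flip x i) * f (flip x i) *
      (ln (f (flip x i)) - ln (resample w i f (flip x i))) =
    w x * f x * ln (f x) + w (flip x i) * f (flip x i) * ln (f (flip x i)) -
    (w x * f x + w (flip x i) * f (flip x i)) *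
      (ln (w x * f x + w (flip x i) * f (flip x i)) - ln (w x + w (flip x i))).
  move=> w0; rewrite resample_flip /resample.
  set S := w x * f x + _; set B := w x + _.
  have B0 : 0 < B by rewrite addr_gt0.
  have m0 y : 0 <= w y * f y by rewrite mulr_ge0 // ltW.
  have [S_eq0|S_neq0] := eqVneq S 0.
    have /eqP : S = 0 by []; rewrite paddr_eq0 // => /andP[/eqP-> /eqP->].
    by rewrite S_eq0 !mul0r addr0 subrr.
  have S0 : 0 < S by rewrite lt_def S_neq0 addr_ge0.
  by rewrite ln_div ?posrE // /S; ring.
have [k0 _|K0] := pickP (fun _ : K => true); last first.
  rewrite big_pred0 // /locEnt big1 // => x _.
  by rewrite big_pred0 // !mul0r.
have Wsum x : 0 < \sum_k W k x.
  by rewrite (bigD1 k0) //= ltr_pwDl // sumr_ge0 // => k _; exact: ltW.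
under eq_bigr do rewrite /locEnt (sum_flip_half _ i).
rewrite -mulr_sumr /locEnt [X in _ <= X](sum_flip_half _ i) ler_pM2l ?invr_gt0 //.
rewrite [X in X <= _]exchange_big /=.
apply: ler_sum => x _ /=.
rewrite mass //; under eq_bigr do rewrite mass //.
rewrite sumrB !mulr_suml -!big_split /= lerD2l lerN2.
apply: log_sum => k.
- by rewrite addr_ge0 // mulr_ge0 // ltW.
- by rewrite addr_ge0 // ltW.
- by move/eqP; rewrite gt_eqF // addr_gt0.
Qed.

Lemma locEnt_scale (k : R) w i f : 0 < k ->
  locEnt (fun x => k * w x) i f = k * locEnt w i f.
Proof.
move=> k0; rewrite /locEnt mulr_sumr; apply: eq_bigr => x _.
have -> : resample (fun x => k * w x) i f x = resample w i f x.
  rewrite /resample -!mulrA -!mulrDr invfM mulrACA divff ?mul1r //.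
  by rewrite gt_eqF.
by rewrite !mulrA.
Qed.

Lemma locEnt_null w i f : (forall x, 0 < w x) -> (forall x, 0 <= f x) ->
  \sum_x w x * f x = 0 -> locEnt w i f = 0.
Proof.
move=> w0 f0 S0; rewrite /locEnt big1 // => x _.
by rewrite (psumr_eq0P (fun y _ => mulr_ge0 (ltW (w0 y)) (f0 y)) S0) // mul0r.
Qed.

(** Tensorisation of entropy. For a product weight, the resampling operators
    commute; applying them one coordinate after the other turns [f] into a
    constant, and each of them loses at most the local entropy of [f] itself
    since resampling another coordinate decreases local entropies. *)
Section ProductWeight.
Variable w : cube n -> R.
Hypothesis w0 : forall x, 0 < w x.
Hypothesis wM : forall x i j, i != j ->
  w (flip x i) * w (flip x j) = w x * w (flip (flip x i) j).

Lemma resampleC i j f x : i != j ->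
  resample w i (resample w j f) x = resample w j (resample w i f) x.
Proof.
move=> ij; rewrite /resample [flip (flip x j) i]flipC.
have -> : w (flip (flip x i) j) = w (flip x i) * w (flip x j) / w x.
  by rewrite wM // mulrC mulKf // gt_eqF.
field; rewrite !gt_eqF // ?addr_gt0 ?mulr_gt0 //.
Qed.

(** Joint convexity of [a * ln (a / b)], applied to [f] and to [resample w i f]
    along the two values of coordinate [j]. *)
Lemma locEnt_resample_le i j f : i != j -> (forall x, 0 <= f x) ->
  locEnt w i (resample w j f) <= locEnt w i f.
Proof.
move=> ij f0; rewrite /locEnt (sum_flip_half _ j) [X in _ <= X](sum_flip_half _ j).
rewrite ler_pM2l ?invr_gt0 //; apply: ler_sum => x _.
rewrite !(resampleC _ _ ij) !resample_flip -!mulrDl.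
set g := resample w i f.
have g0 : forall y, 0 <= g y by exact: resample_ge0.
set D := w x + w (flip x j); have D0 : 0 < D by rewrite addr_gt0.
pose a (b : bool) := if b then w x * f x else w (flip x j) * f (flip x j).
pose c (b : bool) := if b then w x * g x else w (flip x j) * g (flip x j).
have a0 b : 0 <= a b by rewrite /a; case: b; rewrite mulr_ge0 // ltW.
have c0 b : 0 <= c b by rewrite /c; case: b; rewrite mulr_ge0 // ltW.
have fg y : g y = 0 -> f y = 0.
  move=> gy; apply/eqP; apply: contraT => fy.
  have : 0 < g y by apply: resample_gt0 => //; rewrite lt_def fy f0.
  by rewrite gy ltxx.
have ca b : c b = 0 -> a b = 0.
  by rewrite /a /c; case: b => /eqP; rewrite mulf_eq0 gt_eqF //= => /eqP/fg->; rewrite mulr0.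
have := log_sum a0 c0 ca; rewrite /KL !big_bool /=.
have lnr y : w y * f y * (ln (w y * f y) - ln (w y * g y)) =
             w y * f y * (ln (f y) - ln (g y)).
  have [->|fy] := eqVneq (f y) 0; first by rewrite !(mulr0, mul0r).
  have fy0 : 0 < f y by rewrite lt_def fy f0.
  have gy0 : 0 < g y by exact: resample_gt0.
  by rewrite (@lnM _ (w y) (f y)) ?posrE // (@lnM _ (w y) (g y)) ?posrE //; ring.
rewrite !lnr; apply: le_trans.
rewrite /resample -/D -/g.
set S := w x * f x + _; set B := w x * g x + _.
have -> : D * (S / D) = S by rewrite mulrC divfK // gt_eqF.
have [->|S_neq0] := eqVneq S 0; first by rewrite !mul0r.
have S0 : 0 < S by rewrite lt_def S_neq0 (addr_ge0 (a0 true) (a0 false)).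
have B0 : 0 < B.
  rewrite lt_def (addr_ge0 (c0 true) (c0 false)) andbT.
  apply: contra S_neq0; rewrite paddr_eq0 ?(c0 true) ?(c0 false) // => /andP[].
  by move=> /eqP/(ca true) h1 /eqP/(ca false) h2; rewrite /S [w x * _]h1 [w _ * _]h2 addr0.
by rewrite !ln_div ?posrE // opprB addrA subrK.
Qed.

Let resamples l f := foldr (fun i => resample w i) f l.

Let resamples_ge0 l f : (forall x, 0 <= f x) -> forall x, 0 <= resamples l f x.
Proof. by move=> f0; elim: l => //= i l IH; exact: resample_ge0. Qed.

Let locEnt_resamples_le i l f : i \notin l -> (forall x, 0 <= f x) ->
  locEnt w i (resamples l f) <= locEnt w i f.
Proof.
elim: l => //= j l IH; rewrite inE negb_or => /andP[ij il] f0.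
by apply: le_trans (IH il f0); apply: locEnt_resample_le => //; exact: resamples_ge0.
Qed.

Let resamples_flip l f i x : uniq l -> i \in l ->
  resamples l f (flip x i) = resamples l f x.
Proof.
elim: l x => //= j l IH x /andP[jl ul].
have [->|ij] := eqVneq i j; first by rewrite resample_flip.
rewrite inE (negbTE ij) /= => il.
have e y : resamples l f y = resample w i (resamples l f) y.
  by rewrite resample_id // => z; exact: IH.
have {}e : resamples l f = resample w i (resamples l f) by apply/funext.
by rewrite e -!(resampleC _ _ ij) resample_flip.
Qed.

Lemma tensorization f : (forall x, 0 <= f x) ->
  wEnt w f <= \sum_i locEnt w i f.
Proof.
move=> f0.
have main l : uniq l -> wEnt w f - wEnt w (resamples l f) <= \sum_(i <- l) locEnt w i f.
  elim: l => [_|i l IH /=/andP[il ul]]; first by rewrite subrr big_nil.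
  rewrite big_cons; apply: le_trans (lerD (locEnt_resamples_le il f0) (IH ul)).
  by rewrite locEntE // [X in _ <= X]addrC subrKA.
have := main (index_enum 'I_n) (index_enum_uniq _).
suff -> : wEnt w (resamples (index_enum 'I_n) f) = 0 by rewrite subr0.
set g := resamples _ f.
have g_const x y : g x = g y.
  by apply: flip_invariant_const => i z; exact/resamples_flip/mem_index_enum/index_enum_uniq.
pose x0 : cube n := [ffun=> true].
have W0 : 0 < \sum_x w x.
  by rewrite (bigD1 x0) //= ltr_pwDl // sumr_ge0 // => x _; exact: ltW.
rewrite /wEnt.
under eq_bigr do rewrite (g_const _ x0).
under [X in _ - X * _]eq_bigr do rewrite (g_const _ x0).
under [X in ln X - _]eq_bigr do rewrite (g_const _ x0).
rewrite -!mulr_suml.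
have [->|gx] := eqVneq (g x0) 0; first by rewrite !(mulr0, mul0r) subrr.
have gx0 : 0 < g x0 by rewrite lt_def gx resamples_ge0.
by rewrite lnM ?posrE //; ring.
Qed.

End ProductWeight.

End LocalEntropy.

(** * Influences in Ising models of bounded degree *)

Section Influence.
Variables (R : realType) (n : nat).
Implicit Types (w g : cube n -> R) (x : cube n) (i j u v : 'I_n) (e : rel 'I_n)
  (h : 'I_n -> R) (b c : R).
Local Notation sp := (@spin R).

Definition mean w g : R := (\sum_x w x * g x) / \sum_x w x.

Definition cond_mean w i (s : bool) g : R :=
  (\sum_(x : cube n | x i == s) w x * g x) / \sum_(x : cube n | x i == s) w x.

(** Normalised so that the influence of a vertex on itself is 1. *)
Definition influence w i j : R :=
  (cond_mean w i true (fun x => sp (x j)) -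
   cond_mean w i false (fun x => sp (x j))) / 2.

(** The function [tanh (|c| / 2)]. *)
Definition tanh_half c : R := (expR `|c| - 1) / (expR `|c| + 1).

Lemma tanh_half_ge0 c : 0 <= tanh_half c.
Proof.
apply: divr_ge0; last by rewrite addr_ge0 // expR_ge0.
by rewrite subr_ge0 -expR0 ler_expR.
Qed.

Lemma sum_split (V : nmodType) (F : cube n -> V) i :
  \sum_x F x = \sum_(x : cube n | x i == true) F x + \sum_(x : cube n | x i == false) F x.
Proof.
rewrite (bigID (fun x => x i == true)) /=; congr (_ + _).
by apply: eq_bigl => x; case: (x i).
Qed.

Lemma sum_cond_gt0 w i s : (forall x, 0 < w x) ->
  0 < \sum_(x : cube n | x i == s) w x.
Proof.
move=> w0; rewrite (bigD1 [ffun=> s]) /=; last by rewrite ffunE.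
by rewrite ltr_pwDl // sumr_ge0 // => x _; exact: ltW.
Qed.

Lemma sum_gt0 w : (forall x, 0 < w x) -> 0 < \sum_x w x.
Proof.
move=> w0; rewrite (bigD1 [ffun=> true]) //=.
by rewrite ltr_pwDl // sumr_ge0 // => x _; exact: ltW.
Qed.

(** How much the probability of a spin moves when its external field moves:
    the worst case is the symmetric one. *)
Lemma kappa_bound (k A B : R) : 1 <= k -> 0 < A -> 0 < B ->
  0 <= (k - k^-1) * A * B / ((A + B) * (k * A + k^-1 * B)) <= (k - 1) / (k + 1).
Proof.
move=> k1 A0 B0; have k0 : 0 < k by exact: lt_le_trans k1.
have kk : k^-1 <= k by apply: (le_trans _ k1); rewrite invf_le1.
have den : 0 < (A + B) * (k * A + k^-1 * B).
  by rewrite mulr_gt0 ?addr_gt0 ?mulr_gt0 // invr_gt0.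
apply/andP; split.
  apply: divr_ge0; last exact: ltW.
  by rewrite !mulr_ge0 ?subr_ge0 // ltW.
rewrite ler_pdivrMr // [X in _ <= X]mulrAC ler_pdivlMr ?addr_gt0 // -subr_ge0.
have -> : (k - 1) * ((A + B) * (k * A + k^-1 * B)) - (k - k^-1) * A * B * (k + 1)
        = (k - 1) / k * (k * A - B) ^+ 2 by field; rewrite gt_eqF.
by rewrite mulr_ge0 ?sqr_ge0 // divr_ge0 ?subr_ge0 // ltW.
Qed.

(** Tilting by the single spin [x i] only moves the law of that spin. *)
Lemma mean_tilt1_le w i c g : (forall x, 0 < w x) ->
  `|mean (fun x => w x * expR (c * sp (x i))) g - mean w g| <=
  tanh_half c * `|cond_mean w i true g - cond_mean w i false g|.
Proof.
move=> w0; rewrite /mean /cond_mean !(sum_split _ i).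
set k := expR c; have k0 : 0 < k by exact: expR_gt0.
have sT F : \sum_(x : cube n | x i == true) w x * expR (c * sp (x i)) * F x =
         k * \sum_(x : cube n | x i == true) w x * F x.
  rewrite mulr_sumr; apply: eq_bigr => x /eqP ->.
  by rewrite /spin mulr1 -/k mulrCA mulrA.
have sF F : \sum_(x : cube n | x i == false) w x * expR (c * sp (x i)) * F x =
         k^-1 * \sum_(x : cube n | x i == false) w x * F x.
  rewrite mulr_sumr; apply: eq_bigr => x /eqP ->.
  by rewrite /spin mulrN1 expRN -/k mulrCA mulrA.
have sT1 : \sum_(x : cube n | x i == true) w x * expR (c * sp (x i)) =
         k * \sum_(x : cube n | x i == true) w x.
  have := sT (fun=> 1); under eq_bigr do rewrite mulr1.
  by under [in RHS]eq_bigr do rewrite mulr1.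
have sF1 : \sum_(x : cube n | x i == false) w x * expR (c * sp (x i)) =
         k^-1 * \sum_(x : cube n | x i == false) w x.
  have := sF (fun=> 1); under eq_bigr do rewrite mulr1.
  by under [in RHS]eq_bigr do rewrite mulr1.
rewrite sT sF sT1 sF1.
have A0 := sum_cond_gt0 i true w0; have B0 := sum_cond_gt0 i false w0.
set A := \sum_(x | _) w x in A0 *; set B := \sum_(x | _) w x in B0 *.
set GA := \sum_(x | _) _; set GB := \sum_(x | _) _.
have den : 0 < k * A + k^-1 * B by rewrite addr_gt0 ?mulr_gt0 // invr_gt0.
have -> : (k * GA + k^-1 * GB) / (k * A + k^-1 * B) - (GA + GB) / (A + B) =
   (k - k^-1) * A * B / ((A + B) * (k * A + k^-1 * B)) * (GA / A - GB / B).
  field.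
  by rewrite !gt_eqF ?addr_gt0 ?mulr_gt0.
rewrite normrM ler_wpM2r // /tanh_half.
have [c0|c0] := leP 0 c.
  rewrite (ger0_norm c0) -/k.
  have k1 : 1 <= k by rewrite -expR0 ler_expR.
  by have /andP[h1 h2] := kappa_bound k1 A0 B0; rewrite ger0_norm.
rewrite (ltr0_norm c0) expRN -/k.
have k1 : 1 <= k^-1 by rewrite invf_ge1 // -expR0 ler_expR ltW.
have /andP[h1 h2] := kappa_bound k1 B0 A0.
rewrite invrK in h1 h2.
have -> : (k - k^-1) * A * B / ((A + B) * (k * A + k^-1 * B)) =
   - ((k^-1 - k) * B * A / ((B + A) * (k^-1 * B + k * A))).
  by rewrite [B + A]addrC [k^-1 * B + _]addrC -mulNr; congr (_ / _); ring.
by rewrite normrN ger0_norm.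
Qed.

Lemma cov_le_influence w i j : (forall x, 0 < w x) ->
  `|mean w (fun x => sp (x i) * sp (x j)) -
    mean w (fun x => sp (x i)) * mean w (fun x => sp (x j))| <=
  `|influence w i j|.
Proof.
move=> w0; rewrite /influence /mean /cond_mean !(sum_split _ i).
have A0 := sum_cond_gt0 i true w0; have B0 := sum_cond_gt0 i false w0.
have -> : \sum_(x : cube n | x i == true) w x * (sp (x i) * sp (x j)) =
          \sum_(x : cube n | x i == true) w x * sp (x j).
  by apply: eq_bigr => x /eqP ->; rewrite mul1r.
have -> : \sum_(x : cube n | x i == false) w x * (sp (x i) * sp (x j)) =
          - \sum_(x : cube n | x i == false) w x * sp (x j).
  by rewrite -sumrN; apply: eq_bigr => x /eqP ->; rewrite mulN1r mulrN.
have -> : \sum_(x : cube n | x i == true) w x * sp (x i) =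
          \sum_(x : cube n | x i == true) w x.
  by apply: eq_bigr => x /eqP ->; rewrite mulr1.
have -> : \sum_(x : cube n | x i == false) w x * sp (x i) =
          - \sum_(x : cube n | x i == false) w x.
  by rewrite -sumrN; apply: eq_bigr => x /eqP ->; rewrite mulrN1.
set A := \sum_(x | _) w x in A0 *; set B := \sum_(x | _) w x in B0 *.
set GA := \sum_(x | _) _; set GB := \sum_(x | _) _.
have -> : (GA - GB) / (A + B) - (A - B) / (A + B) * ((GA + GB) / (A + B)) =
  4 * A * B / (A + B) ^+ 2 * ((GA / A - GB / B) / 2).
  by field; rewrite !gt_eqF // addr_gt0.
rewrite normrM ler_piMl // ger0_norm.
  rewrite ler_pdivrMr ?exprn_gt0 ?addr_gt0 // mul1r -subr_ge0.
  have -> : (A + B) ^+ 2 - 4 * A * B = (A - B) ^+ 2 by ring.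
  exact: sqr_ge0.
by rewrite divr_ge0 ?sqr_ge0 // !mulr_ge0 // ltW.
Qed.

(** If every row of the influence matrix has absolute sum at most [alpha],
    then so has every row of the covariance matrix, which is symmetric;
    the quadratic form is bounded by the arithmetic-geometric mean inequality. *)
Lemma variance_le w (alpha : R) (a : 'I_n -> R) : (forall x, 0 < w x) ->
    (forall i, \sum_j `|influence w i j| <= alpha) ->
  mean w (fun x => (\sum_i a i * sp (x i)) ^+ 2) -
    mean w (fun x => \sum_i a i * sp (x i)) ^+ 2 <= alpha * \sum_i a i ^+ 2.
Proof.
move=> w0 row.
pose C i j := mean w (fun x => sp (x i) * sp (x j)) -
    mean w (fun x => sp (x i)) * mean w (fun x => sp (x j)).
have -> : mean w (fun x => (\sum_i a i * sp (x i)) ^+ 2) -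
    mean w (fun x => \sum_i a i * sp (x i)) ^+ 2 =
    \sum_i \sum_j a i * a j * C i j.
  have -> : mean w (fun x => (\sum_i a i * sp (x i)) ^+ 2) =
      \sum_i \sum_j a i * a j * mean w (fun x => sp (x i) * sp (x j)).
    rewrite /mean; under [RHS]eq_bigr do under eq_bigr do rewrite mulrA.
    under [RHS]eq_bigr do rewrite -mulr_suml.
    rewrite -mulr_suml; congr (_ / _).
    under [RHS]eq_bigr do under eq_bigr do rewrite mulr_sumr.
    under [RHS]eq_bigr do rewrite exchange_big.
    rewrite exchange_big /=; apply: eq_bigr => x _.
    rewrite expr2 big_distrlr /= mulr_sumr; apply: eq_bigr => i _.
    by rewrite mulr_sumr; apply: eq_bigr => j _; ring.
  have -> : mean w (fun x => \sum_i a i * sp (x i)) =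
      \sum_i a i * mean w (fun x => sp (x i)).
    rewrite /mean; under [RHS]eq_bigr do rewrite mulrA.
    rewrite -mulr_suml; congr (_ / _).
    under [RHS]eq_bigr do rewrite mulr_sumr.
    rewrite exchange_big /=; apply: eq_bigr => x _.
    by rewrite mulr_sumr; apply: eq_bigr => i _; ring.
  rewrite expr2 big_distrlr /= -sumrB; apply: eq_bigr => i _.
  by rewrite -sumrB; apply: eq_bigr => j _; rewrite /C; ring.
have Csym i j : C i j = C j i.
  by rewrite /C mulrC; congr (mean w _ - _); apply/funext => x; rewrite mulrC.
have CI i j : `|C i j| <= `|influence w i j| by exact: cov_le_influence.
apply: (@le_trans _ _ (\sum_i \sum_j `|C i j| * (a i ^+ 2 + a j ^+ 2) / 2)).
  apply: ler_sum => i _; apply: ler_sum => j _.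
  apply: le_trans (ler_norm _) _; rewrite normrM mulrC -mulrA ler_wpM2l //.
  rewrite ler_pdivlMr // normrM -[X in _ <= X + _]real_normK ?num_real //.
  rewrite -[X in _ <= _ + X]real_normK ?num_real // -subr_ge0.
  have -> : `|a i| ^+ 2 + `|a j| ^+ 2 - `|a i| * `|a j| * 2 =
            (`|a i| - `|a j|) ^+ 2 by ring.
  exact: sqr_ge0.
have -> : \sum_i \sum_j `|C i j| * (a i ^+ 2 + a j ^+ 2) / 2 =
          \sum_i \sum_j `|C i j| * a i ^+ 2.
  have e : \sum_i \sum_j `|C i j| * a j ^+ 2 = \sum_i \sum_j `|C i j| * a i ^+ 2.
    rewrite exchange_big; apply: eq_bigr => i _; apply: eq_bigr => j _.
    by rewrite Csym.
  have -> : \sum_i \sum_j `|C i j| * (a i ^+ 2 + a j ^+ 2) / 2 =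
    2^-1 * (\sum_i \sum_j `|C i j| * a i ^+ 2 + \sum_i \sum_j `|C i j| * a j ^+ 2).
    rewrite -big_split mulr_sumr; apply: eq_bigr => i _.
    by rewrite -big_split mulr_sumr; apply: eq_bigr => j _; rewrite mulrDr mulrC.
  by rewrite e; field.
rewrite mulr_sumr; apply: ler_sum => i _; rewrite -mulr_suml.
rewrite ler_wpM2r ?sqr_ge0 //; apply: le_trans (row i).
by apply: ler_sum => j _.
Qed.

End Influence.

Section Gibbs.
Variables (R : realType) (n : nat).
Implicit Types (x : cube n) (i j u v : 'I_n) (e : rel 'I_n)
  (h : 'I_n -> R) (b c : R).
Local Notation sp := (@spin R).

(** Ising weight with interaction [b * x_u * x_v] on every edge, which the double
    sum sees twice, and arbitrary external fields. *)
Definition gibbs e b h x : R :=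
  expR (b / 2 * \sum_u \sum_v (e u v)%:R * (sp (x u) * sp (x v)) +
        \sum_u h u * sp (x u)).

Lemma gibbs_gt0 e b h x : 0 < gibbs e b h x.
Proof. exact: expR_gt0. Qed.

Definition degree e i : nat := #|[set j | e i j]%SET|.

Definition del e i : rel 'I_n := [rel u v | [&& e u v, u != i & v != i]].

(** Vertex [i] itself becomes a free spin without field, so that the graph keeps
    its vertex set when [i] is deleted. *)
Definition frozen_field e b h i (s : bool) j : R :=
  if j == i then 0 else h j + b * sp s * (e i j)%:R.

Lemma sum_delta (F : 'I_n -> R) i : \sum_u (u == i)%:R * F u = F i.
Proof.
rewrite (bigD1 i) //= eqxx mul1r big1 ?addr0 // => u ui.
by rewrite (negbTE ui) mul0r.
Qed.

(** The edges at [i] act on a frozen spin as external fields on its neighbours. *)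
Lemma gibbs_frozen e b h i s x : symmetric e -> irreflexive e -> x i = s ->
  gibbs e b h x = expR (h i * sp s) * gibbs (del e i) b (frozen_field e b h i s) x.
Proof.
move=> esym eirr xi; rewrite /gibbs -expRD; congr expR.
have -> : \sum_u \sum_v (e u v)%:R * (sp (x u) * sp (x v)) =
  \sum_u \sum_v (del e i u v)%:R * (sp (x u) * sp (x v)) +
  2 * (sp s * \sum_v (e i v)%:R * sp (x v)).
  have -> : 2 * (sp s * \sum_v (e i v)%:R * sp (x v)) =
    \sum_u (u == i)%:R * (\sum_v (e i v)%:R * (sp (x u) * sp (x v))) +
    \sum_u \sum_v (v == i)%:R * ((e u i)%:R * (sp (x u) * sp (x v))).
    rewrite sum_delta; under [X in _ = _ + X]eq_bigr do rewrite sum_delta.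
    rewrite mulrDl mul1r mulr_sumr xi; congr (_ + _); apply: eq_bigr => v _.
      by rewrite mulrCA.
    by rewrite esym mulrCA; congr (_ * _); rewrite mulrC.
  rewrite -big_split -big_split; apply: eq_bigr => u _ /=.
  rewrite mulr_sumr -big_split -big_split; apply: eq_bigr => v _ /=.
  have [->|ui] := eqVneq u i; have [->|vi] := eqVneq v i;
    rewrite /del /= ?eqxx ?ui ?vi ?eirr /= ?andbF ?andbT ?mul0r ?mul1r ?add0r ?addr0 //.
have -> : \sum_u h u * sp (x u) = h i * sp s + \sum_u (u != i)%:R * (h u * sp (x u)).
  rewrite -xi -(sum_delta (fun u => h u * sp (x u)) i) -big_split; apply: eq_bigr => u _ /=.
  by case: (u == i); rewrite /= ?mul0r ?mul1r ?addr0 ?add0r.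
have -> : \sum_u frozen_field e b h i s u * sp (x u) =
  \sum_u (u != i)%:R * (h u * sp (x u)) + b * sp s * \sum_v (e i v)%:R * sp (x v).
  rewrite mulr_sumr -big_split; apply: eq_bigr => u _ /=.
  rewrite /frozen_field; have [->|ui] := eqVneq u i; rewrite /= ?eirr /=; [ring|ring].
by field.
Qed.

Lemma gibbs_frozen_flip e b h i s x :
  gibbs (del e i) b (frozen_field e b h i s) (flip x i) =
  gibbs (del e i) b (frozen_field e b h i s) x.
Proof.
rewrite /gibbs; congr (expR (_ * _ + _)); apply: eq_bigr => u _.
  apply: eq_bigr => v _; rewrite !flipE /del /=.
  by case: (u == i); case: (v == i); rewrite /= ?andbF ?mul0r.
by rewrite flipE /frozen_field; case: (u == i); rewrite ?mul0r.
Qed.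

Lemma sum_cond_half (F : cube n -> R) i s : (forall x, F (flip x i) = F x) ->
  \sum_(x : cube n | x i == s) F x = 2^-1 * \sum_x F x.
Proof.
move=> Fi; have e : \sum_(x : cube n | x i == true) F x =
    \sum_(x : cube n | x i == false) F x.
  rewrite (reindex_inj (inv_inj (flipK i))) /=; apply: eq_big => x.
    by rewrite flipE eqxx; case: (x i).
  by rewrite Fi.
by rewrite (sum_split _ i) e; case: s; rewrite ?e; field.
Qed.

(** Once vertex [i] is deleted its spin is uniform and independent of the others,
    so that conditioning on it can be dropped. *)
Lemma cond_mean_gibbs e b h i s g : symmetric e -> irreflexive e ->
    (forall x, g (flip x i) = g x) ->
  cond_mean (gibbs e b h) i s g =
  mean (gibbs (del e i) b (frozen_field e b h i s)) g.
Proof.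
move=> esym eirr gi; rewrite /cond_mean /mean.
set W := gibbs (del e i) b _.
have Wi x : W (flip x i) = W x by exact: gibbs_frozen_flip.
have -> : \sum_(x : cube n | x i == s) gibbs e b h x * g x =
    expR (h i * sp s) * (2^-1 * \sum_x W x * g x).
  rewrite -(@sum_cond_half _ i s) => [|x]; last by rewrite Wi gi.
  by rewrite mulr_sumr; apply: eq_bigr => x /eqP xi; rewrite (gibbs_frozen _ _ esym eirr xi) mulrA.
have -> : \sum_(x : cube n | x i == s) gibbs e b h x =
    expR (h i * sp s) * (2^-1 * \sum_x W x).
  rewrite -(@sum_cond_half _ i s) => [|x]; last exact: Wi.
  by rewrite mulr_sumr; apply: eq_bigr => x /eqP xi; rewrite (gibbs_frozen _ _ esym eirr xi).
have W0 : 0 < \sum_x W x by apply: sum_gt0 => x; exact: gibbs_gt0.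
by field; rewrite !gt_eqF // expR_gt0.
Qed.

(** Change the fields one vertex after the other; each change moves the law of a
    single spin, whose influence on the others is at most [s]. *)
Lemma mean_tilts_le e b (s c : R) (l : seq 'I_n) h :
    (forall u h', u \in l -> \sum_j `|influence (gibbs e b h') u j| <= s) ->
  \sum_j `|mean (gibbs e b (fun v => h v + c * (count_mem v l)%:R)) (fun x => sp (x j)) -
           mean (gibbs e b h) (fun x => sp (x j))| <=
  (size l)%:R * (2 * (tanh_half c * s)).
Proof.
elim: l h => [|u l IH] h row.
  rewrite mul0r big1 // => j _.
  have -> : (fun v => h v + c * (count_mem v [::])%:R) = h.
    by apply/funext => v; rewrite mulr0 addr0.
  by rewrite subrr normr0.
pose h' v := h v + c * (v == u)%:R.
have tilt : gibbs e b h' = fun x => gibbs e b h x * expR (c * sp (x u)).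
  apply/funext => x; rewrite /gibbs -expRD -addrA; congr (expR (_ + _)).
  rewrite -(sum_delta (fun v => c * sp (x v)) u) -big_split.
  by apply: eq_bigr => v _; rewrite /h' /=; ring.
have -> : (fun v => h v + c * (count_mem v (u :: l))%:R) =
          (fun v => h' v + c * (count_mem v l)%:R).
  by apply/funext => v; rewrite /h' /= natrD eq_sym; ring.
have {}IH : _ := IH h' (fun v h'' (vl : v \in l) => row v h'' (@mem_behead _ (u :: l) v vl)).
rewrite /= -natr1 mulrDl mul1r.
have step : \sum_j `|mean (gibbs e b h') (fun x => sp (x j)) -
    mean (gibbs e b h) (fun x => sp (x j))| <= 2 * (tanh_half c * s).
  apply: (@le_trans _ _ (2 * (tanh_half c * \sum_j `|influence (gibbs e b h) u j|))).
    rewrite !mulr_sumr; apply: ler_sum => j _; rewrite tilt.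
    apply: le_trans (mean_tilt1_le _ _ _ (gibbs_gt0 e b h)) _.
    rewrite [X in _ <= X]mulrCA ler_wpM2l ?tanh_half_ge0 // /influence normrM.
    by rewrite [`|2^-1|]ger0_norm // mulrC divfK.
  by rewrite ler_pM2l // ler_wpM2l ?tanh_half_ge0 // row // mem_head.
apply: le_trans (lerD IH step).
rewrite -big_split; apply: ler_sum => j _ /=.
exact: ler_distD.
Qed.

Lemma degree_del e i u : symmetric e -> e i u ->
  ((degree (del e i) u).+1 <= degree e u)%N.
Proof.
move=> esym eiu; apply: proper_card; apply/properP; split.
  by apply/fintype.subsetP => v; rewrite !inE => /and3P[].
by exists i; rewrite !inE /del /= ?eqxx ?andbF // esym.
Qed.

(** Weitz's self-avoiding walk bound, by induction on the graph. Freezing [i]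
    to either value yields the Ising model on the graph without [i], with
    external fields that differ by [2 * b] on the neighbours of [i] only; in
    that graph each neighbour has lost an edge. Moving the field of one
    neighbour [u] at a time, the influence of [i] is at most
    [tanh_half (2 * b)] times the sum of the influences of its neighbours. *)
Lemma influence_row_le (D : nat) (b s : R) :
    0 <= s -> 1 + D%:R * (tanh_half (2 * b) * s) <= s ->
  forall (S : {set 'I_n}) e h i, symmetric e -> irreflexive e ->
    (forall u, (degree e u <= D.+1)%N) -> (forall u v, e u v -> u \in S) ->
    i \in S ->
  \sum_j `|influence (gibbs e b h) i j| <=
  1 + (degree e i)%:R * (tanh_half (2 * b) * s).
Proof.
move=> s0 hs S; have [k] := ubnP #|S|.
elim: k S => // k IH S; rewrite ltnS => Sk e h i esym eirr deg eS iS.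
have ts0 : 0 <= tanh_half (2 * b) * s by rewrite mulr_ge0 // tanh_half_ge0.
pose l := enum [set j | e i j]%SET.
have szl : size l = degree e i by rewrite -cardE.
have row u h' : u \in l -> \sum_j `|influence (gibbs (del e i) b h') u j| <= s.
  rewrite mem_enum inE => eiu; apply: le_trans hs.
  have esub v v' : del e i v v' -> e v v' by case/and3P.
  have dsym : symmetric (del e i).
    by move=> v v'; rewrite /del /= esym [(v != i) && _]andbC.
  have dD v : (degree (del e i) v <= degree e v)%N.
    by apply: subset_leq_card; apply/fintype.subsetP => v'; rewrite !inE => /and3P[].
  apply: (le_trans (IH (S :\ i)%SET _ (del e i) h' u dsym _ _ _ _)).
  - by apply: leq_trans Sk; rewrite (cardsD1 i S) iS.
  - by move=> v; rewrite /del /= eirr.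
  - by move=> v; exact: leq_trans (dD v) (deg v).
  - by move=> v v' /and3P[/eS vS vi _]; rewrite !inE vi.
  - have uS : u \in S by apply: (eS u i); rewrite esym.
    rewrite !inE uS andbT.
    by apply: contraTneq eiu => ->; rewrite eirr.
  rewrite lerD2l ler_wpM2r // ler_nat -ltnS.
  exact: leq_trans (degree_del esym eiu) (deg u).
have fields : frozen_field e b h i true =
    (fun v => frozen_field e b h i false v + 2 * b * (count_mem v l)%:R).
  apply/funext => v; rewrite count_uniq_mem ?enum_uniq // mem_enum inE /frozen_field.
  by have [->|vi] := eqVneq v i; rewrite ?eirr /spin /=; ring.
have := mean_tilts_le (2 * b) (frozen_field e b h i false) row.
rewrite -fields szl => tilts.
rewrite (bigD1 i) //=; apply: lerD.
  rewrite /influence /cond_mean.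
  have -> : \sum_(x : cube n | x i == true) gibbs e b h x * sp (x i) =
      \sum_(x : cube n | x i == true) gibbs e b h x.
    by apply: eq_bigr => x /eqP ->; rewrite mulr1.
  have -> : \sum_(x : cube n | x i == false) gibbs e b h x * sp (x i) =
      - \sum_(x : cube n | x i == false) gibbs e b h x.
    by rewrite -sumrN; apply: eq_bigr => x /eqP ->; rewrite mulrN1.
  rewrite mulNr !divff ?gt_eqF ?sum_cond_gt0 //; try exact: gibbs_gt0.
  by rewrite opprK ger0_norm // divff.
have -> : (degree e i)%:R * (tanh_half (2 * b) * s) =
    2^-1 * ((degree e i)%:R * (2 * (tanh_half (2 * b) * s))) by field.
apply: le_trans (ler_wpM2l _ tilts); last by rewrite invr_ge0.
rewrite mulr_sumr [X in _ <= X](bigD1 i) //= ler_wpDl ?mulr_ge0 ?invr_ge0 //.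
apply: ler_sum => j ji; rewrite /influence.
rewrite !cond_mean_gibbs // => [|x|x]; try by rewrite flipE (negbTE ji).
by rewrite normrM [`|2^-1|]ger0_norm ?invr_ge0 // mulrC.
Qed.

End Gibbs.

(** * Scalar inequalities for the logarithm *)

Section Calculus.
Variable R : realType.
Implicit Types (F dF : R -> R) (a b x y r : R).

Lemma derive_ge0_le F dF a b : a <= b ->
    (forall x, a <= x <= b -> is_derive x 1 F (dF x)) ->
    (forall x, a <= x <= b -> 0 <= dF x) ->
  F a <= F b.
Proof.
move=> ab Fd dF0; rewrite -subr_ge0.
have [||c cab ->] := @MVT_segment R F dF a b ab.
- by move=> x; rewrite in_itv /= => /andP[ax xb]; apply: Fd; rewrite !ltW.
- apply: derivable_within_continuous => x; rewrite in_itv /= => xab.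
  exact: (@ex_derive _ _ _ _ _ _ _ (Fd x xab)).
- by rewrite mulr_ge0 ?subr_ge0 // dF0 // -in_itv.
Qed.

Lemma ln_ge_sub_inv r : 0 < r -> 1 - r^-1 <= ln r.
Proof.
move=> r0; have := @le_ln1Dx R (r^-1 - 1).
rewrite addrCA subrr addr0 lnV ?posrE // ltrBrDr addNr invr_gt0.
by move=> /(_ r0); rewrite lerNl opprB.
Qed.

Lemma ln_le_sub r : 0 < r -> ln r <= r - 1.
Proof.
move=> r0; have := @le_ln1Dx R (r - 1); rewrite addrCA subrr addr0; apply.
by rewrite ltrBrDr addNr.
Qed.

Lemma ln_le_half_sub_inv y : 1 <= y -> ln y <= (y - y^-1) / 2.
Proof.
move=> y1; rewrite -subr_ge0.
pose F x := (x - x^-1) / 2 - ln x.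
have -> : 0 = F 1 by rewrite /F ln1 invr1 subrr mul0r subrr.
apply: (@derive_ge0_le F (fun x => (1 + x ^- 2) / 2 - x^-1)) => // x /andP[x1 _].
  have x0 : 0 < x by exact: lt_le_trans x1.
  have x_neq0 : x != 0 by rewrite gt_eqF.
  have h1 := is_deriveV x_neq0 (is_derive_id x (1 : R)).
  have h2 := is_deriveB (is_derive_id x (1 : R)) h1.
  have h3 := is_deriveB (is_deriveZ 2^-1 h2) (is_derive1_ln x0).
  have -> : F = 2^-1 \*: (id - (fun y => (id y)^-1)) - @ln R.
    by apply/funext => z; rewrite /F mulrC.
  by apply: is_derive_eq h3 _; rewrite /GRing.scale /=; field.
have x0 : 0 < x by exact: lt_le_trans x1.
have -> : (1 + x ^- 2) / 2 - x^-1 = (1 - x^-1) ^+ 2 / 2 by field; rewrite gt_eqF.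
by rewrite divr_ge0 ?sqr_ge0.
Qed.

(** The constant tends to 1/2 near 1; any value below 2/3 leaves enough room for
    the exponent [8 / delta]. *)
Lemma xlnx_le r : 5 / 6 <= r -> r * ln r - r + 1 <= 3 / 5 * (r - 1) ^+ 2.
Proof.
move=> r56; rewrite -subr_ge0.
pose F x := 3 / 5 * (x - 1) ^+ 2 - (x * ln x - x + 1).
pose dF x := 6 / 5 * (x - 1) - ln x.
have F1 : F 1 = 0 by rewrite /F ln1; ring.
have Fd x : 0 < x -> is_derive x 1 F (dF x).
  move=> x0; have x_neq0 : x != 0 by rewrite gt_eqF.
  have h1 := is_deriveM (is_derive_id x (1 : R)) (is_derive1_ln x0).
  have h2 := is_deriveB (is_derive_id x (1 : R)) (is_derive_cst (1 : R) x (1 : R)).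
  have h3 := is_deriveB (is_deriveZ (3 / 5) (is_deriveX 2 h2)) (is_deriveB h1 h2).
  match type of h3 with is_derive _ _ ?f _ => have <- : f = F end.
    apply/funext => z.
    transitivity (3 / 5 * (z - 1) ^+ 2 - (z * ln z - (z - 1))); first by [].
    by rewrite /F; ring.
  apply: is_derive_eq h3 _.
  transitivity (3 / 5 * (2 * (x - 1) ^+ 1 * (1 - 0)) -
                (x * x^-1 + ln x * 1 - (1 - 0))); first by [].
  by rewrite /dF; field.
have [r1|r1] := leP 1 r.
  have := @derive_ge0_le F dF 1 r r1; rewrite F1; apply => x /andP[x1 _].
    by apply: Fd; exact: lt_le_trans x1.
  by rewrite /dF; have := ln_le_sub (lt_le_trans ltr01 x1); lra.
have dFN x : 5 / 6 <= x <= 1 -> 0 <= - dF x.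
  move=> /andP[x56 x1]; have x0 : 0 < x by apply: lt_le_trans x56; lra.
  rewrite oppr_ge0 /dF subr_le0; apply: le_trans (ln_ge_sub_inv x0).
  rewrite -subr_ge0.
  have -> : 1 - x^-1 - 6 / 5 * (x - 1) = (1 - x) * (6 / 5 * x - 1) / x.
    by field; rewrite gt_eqF.
  by rewrite divr_ge0 ?mulr_ge0 //; lra.
have := @derive_ge0_le (fun x => - F x) (fun x => - dF x) r 1 (ltW r1).
rewrite F1 oppr0 oppr_le0; apply => x /andP[rx x1].
  have x0 : 0 < x by apply: lt_le_trans (le_trans r56 rx); lra.
  exact: is_deriveN (Fd x x0).
by apply: dFN; rewrite x1 (le_trans r56).
Qed.

End Calculus.

(** * Covariance bounds control the transport of means *)

Section LogLaplace.
Variables (R : realType) (T : finType).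
Variables (w X : T -> R) (V : R).
Hypothesis w0 : forall x, 0 < w x.
Hypothesis T0 : T.

(** Up to normalisation, the moments of [X] under the weight tilted by [s * X]. *)
Definition moment (k : nat) (s : R) : R := \sum_x w x * X x ^+ k * expR (s * X x).

Local Lemma moment_gt0 s : 0 < moment 0 s.
Proof.
rewrite /moment (bigD1 T0) //= ltr_pwDl //.
  by rewrite expr0 mulr1 mulr_gt0 // expR_gt0.
by apply: sumr_ge0 => x _; rewrite expr0 mulr1 mulr_ge0 ?expR_ge0 // ltW.
Qed.

Local Lemma is_derive_moment (k : nat) (s : R) :
  is_derive s (1 : R) (moment k) (moment k.+1 s).
Proof.
rewrite /moment; elim: (index_enum T) => [|x l IH].
  rewrite big_nil.
  have -> : (fun s => \sum_(x <- [::]) w x * X x ^+ k * expR (s * X x)) = cst 0.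
    by apply/funext => s'; rewrite big_nil.
  exact: is_derive_cst.
rewrite big_cons.
have -> : (fun s => \sum_(x <- x :: l) w x * X x ^+ k * expR (s * X x)) =
  (w x * X x ^+ k) \*: (expR \o (X x \*: id)) +
  (fun s => \sum_(x <- l) w x * X x ^+ k * expR (s * X x)).
  by apply/funext => s'; rewrite big_cons !fctE /= [X x *: _]mulrC.
have h := is_derive1_comp (is_derive_expR (X x *: s))
  (is_deriveZ (X x) (is_derive_id s (1 : R))).
apply: is_derive_eq (is_deriveD (is_deriveZ (w x * X x ^+ k) h) IH) _.
by rewrite /GRing.scale /= exprS [X x * s]mulrC; ring.
Qed.

Hypothesis varV : forall s,
  moment 2 s / moment 0 s - (moment 1 s / moment 0 s) ^+ 2 <= V.

(** The second derivative of the log-Laplace transform of [X] is the variance of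
    [X] under the tilted weight; integrate the bound twice. *)
Lemma ln_laplace_le :
  ln (\sum_x w x * expR (X x)) - ln (\sum_x w x) <=
  (\sum_x w x * X x) / (\sum_x w x) + V / 2.
Proof.
have Zn s : moment 0 s != 0 by rewrite gt_eqF // moment_gt0.
pose M s := moment 1 s / moment 0 s.
have M_der (s : R) : is_derive s (1 : R) M (moment 2 s / moment 0 s - M s ^+ 2).
  have h := is_deriveM (is_derive_moment 1 s) (is_deriveV (Zn s) (is_derive_moment 0 s)).
  apply: is_derive_eq h _; rewrite /M /GRing.scale /=; field.
  exact: Zn.
have M_le s : 0 <= s -> M s <= M 0 + V * s.
  move=> s0; rewrite -subr_ge0.
  have := @derive_ge0_le R (fun s => V * s - M s)
    (fun s => V - (moment 2 s / moment 0 s - M s ^+ 2)) 0 s s0.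
  rewrite mulr0 sub0r => h; rewrite -[_ + _ - _]addrA -lerBlDl sub0r.
  apply: h => x _; last by rewrite subr_ge0.
  have h := is_deriveB (is_deriveZ V (is_derive_id x (1 : R))) (M_der x).
  by apply: is_derive_eq h _; rewrite /GRing.scale /= mulr1.
pose F s := M 0 * s + V / 2 * s ^+ 2 - ln (moment 0 s).
have Fd (s : R) : is_derive s (1 : R) F (M 0 + V * s - M s).
  have h1 := is_deriveZ (M 0) (is_derive_id s (1 : R)).
  have h2 := is_deriveZ (V / 2) (is_deriveX 2 (is_derive_id s (1 : R))).
  have h3 := is_derive1_comp (is_derive1_ln (moment_gt0 s)) (is_derive_moment 0 s).
  have h := is_deriveB (is_deriveD h1 h2) h3.
  apply: is_derive_eq h _; rewrite /M /GRing.scale /=; field.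
  by rewrite !Zn.
have F01 : F 0 <= F 1.
  apply: (derive_ge0_le ler01 (fun x _ => Fd x)) => x /andP[x0 _].
  by rewrite subr_ge0 M_le.
have Z0 k : moment k 0 = \sum_x w x * X x ^+ k.
  by apply: eq_bigr => x _; rewrite mul0r expR0 mulr1.
have Z1 : moment 0 1 = \sum_x w x * expR (X x).
  by apply: eq_bigr => x _; rewrite mul1r expr0 mulr1.
move: F01; rewrite /F /M Z1 !Z0.
have -> : \sum_x w x * X x ^+ 0 = \sum_x w x by under eq_bigr do rewrite expr0 mulr1.
have -> : \sum_x w x * X x ^+ 1 = \sum_x w x * X x by [].
by lra.
Qed.

End LogLaplace.

(** The Donsker-Varadhan bound: the log-sum inequality against [nu] tilted by [X]. *)
Lemma KL_dual (R : realType) (T : finType) (mu nu X : T -> R) :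
    (forall x, 0 <= mu x) -> (forall x, 0 < nu x) -> \sum_x mu x = 1 ->
  \sum_x mu x * X x - ln (\sum_x nu x * expR (X x)) <= KL mu nu.
Proof.
move=> mu0 nu0 mu1.
have nuX0 x : 0 < nu x * expR (X x) by rewrite mulr_gt0 // expR_gt0.
have nuX_neq0 x : nu x * expR (X x) = 0 -> mu x = 0.
  by move=> nux; have := nuX0 x; rewrite nux ltxx.
have := log_sum mu0 (fun x => ltW (nuX0 x)) nuX_neq0.
rewrite mu1 ln1 mul1r => h.
have -> : KL mu nu = KL mu (fun x => nu x * expR (X x)) + \sum_x mu x * X x.
  rewrite -big_split; apply: eq_bigr => x _ /=.
  by rewrite lnM ?posrE ?expR_gt0 // expRK; ring.
by rewrite addrC lerD2r -sub0r.
Qed.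

Section Transport.
Variables (R : realType) (n : nat).
Variables (e : rel 'I_n) (b alpha : R).
Hypothesis alpha0 : 0 < alpha.
Hypothesis row : forall h i, \sum_j `|influence (gibbs e b h) i j| <= alpha.

(** Test the dual bound on the linear functional given by the displacement of
    the mean itself, divided by [alpha]. All tilts of the measure by linear
    functionals are Ising measures, whose covariances are at most [alpha]. *)
Lemma mean_displacement_le h (mu nu : cube n -> R) :
    (forall x, nu x = gibbs e b h x / \sum_y gibbs e b h y) ->
    (forall x, 0 <= mu x) -> \sum_x mu x = 1 ->
  \sum_i (\sum_x (mu x - nu x) * spin R (x i)) ^+ 2 <= 2 * alpha * KL mu nu.
Proof.
move=> nuE mu0 mu1; set w := gibbs e b h in nuE *.
have w0 x : 0 < w x by exact: gibbs_gt0.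
have W0 : 0 < \sum_x w x by exact: sum_gt0.
have nu0 x : 0 < nu x by rewrite nuE divr_gt0.
pose D i := \sum_x (mu x - nu x) * spin R (x i).
pose a i := D i / alpha.
pose X (x : cube n) := \sum_i a i * spin R (x i).
have tilt s x : w x * expR (s * X x) = gibbs e b (fun i => h i + s * a i) x.
  rewrite /w /gibbs -expRD -addrA; congr (expR (_ + _)).
  by rewrite mulr_sumr -big_split; apply: eq_bigr => i _ /=; ring.
have lap := @ln_laplace_le R _ w X (alpha * \sum_i a i ^+ 2) w0 [ffun=> true].
have {lap} : ln (\sum_x w x * expR (X x)) - ln (\sum_x w x) <=
    (\sum_x w x * X x) / (\sum_x w x) + (alpha * \sum_i a i ^+ 2) / 2.
  apply: lap => s; rewrite /moment.
  have := @variance_le R n (gibbs e b (fun i => h i + s * a i)) alpha a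
    (gibbs_gt0 _ _ _) (row _).
  rewrite /mean.
  have E (k : nat) : \sum_x w x * X x ^+ k * expR (s * X x) =
      \sum_x gibbs e b (fun i => h i + s * a i) x * X x ^+ k.
    by apply: eq_bigr => x _; rewrite mulrAC tilt.
  rewrite !E; set g := gibbs _ _ _.
  by have -> : \sum_x g x * X x ^+ 0 = \sum_x g x by under eq_bigr do rewrite expr0 mulr1.
have -> : ln (\sum_x w x * expR (X x)) - ln (\sum_x w x) =
    ln (\sum_x nu x * expR (X x)).
  rewrite -ln_div ?posrE //; last first.
    by rewrite sum_gt0 // => x; rewrite mulr_gt0 // expR_gt0.
  by rewrite mulr_suml; congr ln; apply: eq_bigr => x _; rewrite nuE mulrAC.
have -> : (\sum_x w x * X x) / (\sum_x w x) = \sum_x nu x * X x.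
  by rewrite mulr_suml; apply: eq_bigr => x _; rewrite nuE mulrAC.
have := KL_dual X mu0 nu0 mu1.
have DX : \sum_x mu x * X x - \sum_x nu x * X x = \sum_i D i ^+ 2 / alpha.
  rewrite -sumrB; under eq_bigr do rewrite -mulrBl mulr_sumr.
  transitivity (\sum_i \sum_x (mu x - nu x) * (a i * spin R (x i))).
    exact: exchange_big.
  apply: eq_bigr => i _.
  rewrite expr2 -mulrA {1}/D mulr_suml; apply: eq_bigr => x _.
  by rewrite /a; ring.
rewrite -mulr_suml in DX.
have -> : \sum_i a i ^+ 2 = (\sum_i D i ^+ 2) / alpha ^+ 2.
  by rewrite mulr_suml; apply: eq_bigr => i _; rewrite exprMn exprVn.
set S := \sum_i D i ^+ 2 in DX *.
have -> : alpha * (S / alpha ^+ 2) = S / alpha by field; rewrite gt_eqF.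
move=> h1 h2.
have : S / alpha <= 2 * KL mu nu by lra.
by rewrite ler_pdivrMr // mulrAC.
Qed.

End Transport.

(** * Observing many weak independent signals *)

Section Signals.
Variables (R : realType) (T K : finType).
Implicit Types (mu nu w f : T -> R) (s : {ffun K -> bool}).
Variables (a : K -> T -> R) (tau : R).
Hypothesis tau0 : 0 <= tau.
Hypothesis tau1 : tau < 1.
Hypothesis a_tau : forall k x, `|a k x| <= tau.

Let m := #|K|.
Local Notation sp := (@spin R).

(** The probability of the bits [s] given [x], when the signals are independent
    signs of means [a k x]. *)
Definition signal s x : R := \prod_k ((1 + sp (s k) * a k x) / 2).

Definition push mu s : R := \sum_x mu x * signal s x.

Lemma signal_factor_bounds (b : bool) k x :
  (1 - tau) / 2 <= (1 + sp b * a k x) / 2 <= (1 + tau) / 2.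
Proof.
have /ler_normlP[h1 h2] := a_tau k x.
by apply/andP; split; rewrite ler_pM2r ?invr_gt0 // /spin; case: b; lra.
Qed.

Lemma signal_bounds s x :
  ((1 - tau) / 2) ^+ m <= signal s x <= ((1 + tau) / 2) ^+ m.
Proof.
have t0 : 0 <= (1 - tau) / 2 by rewrite divr_ge0 // subr_ge0 ltW.
rewrite -!prodr_const; apply/andP; split; apply: ler_prod => k _.
  by have /andP[-> _] := signal_factor_bounds (s k) k x; rewrite t0.
have /andP[h ->] := signal_factor_bounds (s k) k x.
by rewrite andbT (le_trans t0).
Qed.

Lemma signal_gt0 s x : 0 < signal s x.
Proof.
have /andP[h _] := signal_bounds s x; apply: lt_le_trans h.
by rewrite exprn_gt0 // divr_gt0 // subr_gt0.
Qed.

Lemma sum_signal x : \sum_s signal s x = 1.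
Proof.
rewrite /signal -(bigA_distr_bigA (fun k b => (1 + sp b * a k x) / 2)) big1 // => k _.
by rewrite big_bool /spin /=; field.
Qed.

Lemma sum_push mu : \sum_s push mu s = \sum_x mu x.
Proof.
rewrite /push exchange_big; apply: eq_bigr => x _ /=.
by rewrite -mulr_sumr sum_signal mulr1.
Qed.

Lemma push_ge mu s : (forall x, 0 <= mu x) ->
  ((1 - tau) / 2) ^+ m * \sum_x mu x <= push mu s.
Proof.
move=> mu0; rewrite mulr_sumr; apply: ler_sum => x _; rewrite mulrC ler_wpM2l //.
by have /andP[] := signal_bounds s x.
Qed.

Lemma push_le mu s : (forall x, 0 <= mu x) ->
  push mu s <= ((1 + tau) / 2) ^+ m * \sum_x mu x.
Proof.
move=> mu0; rewrite mulr_sumr; apply: ler_sum => x _.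
rewrite [X in _ <= X]mulrC ler_wpM2l //.
by have /andP[] := signal_bounds s x.
Qed.

(** Under the uniform law of the bits, the sign of signal [k] is centred, so that
    only the terms of degree 0 and 2 in it remain. *)
Lemma sum_signal_signal x y :
  \sum_s signal s x * signal s y = 2^-1 ^+ m * \prod_k (1 + a k x * a k y).
Proof.
have e s : signal s x * signal s y =
    \prod_k ((1 + sp (s k) * a k x) / 2 * ((1 + sp (s k) * a k y) / 2)).
  by rewrite big_split.
under [LHS]eq_bigr do rewrite e.
rewrite -(bigA_distr_bigA (fun k b => (1 + sp b * a k x) / 2 * ((1 + sp b * a k y) / 2))).
have -> : 2^-1 ^+ m = \prod_(k : K) 2^-1 :> R by rewrite prodr_const.
rewrite -[RHS]big_split /=; apply: eq_bigr => k _.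
by rewrite big_bool /spin /=; field.
Qed.

(** The factor [2 ^+ size l] is crude, but [l] stays fixed while [zeta] tends to 0. *)
Lemma prod1D_approx (I : Type) (l : seq I) (z : I -> R) (zeta : R) :
    zeta <= 1 -> (forall i, `|z i| <= zeta) ->
  `|\prod_(i <- l) (1 + z i) - 1 - \sum_(i <- l) z i| <= 2 ^+ size l * zeta ^+ 2.
Proof.
move=> zeta1 zz.
have [i0|noI] := pselect (inhabited I); last first.
  case: l => [|i]; last by case: noI; exact: (inhabits i).
  by rewrite !big_nil subrr subrr normr0 mulr_ge0 ?sqr_ge0.
have zeta0 : 0 <= zeta by case: i0 => i; exact: le_trans (normr_ge0 _) (zz i).
suff : [/\ `|\prod_(i <- l) (1 + z i)| <= 2 ^+ size l,
           `|\prod_(i <- l) (1 + z i) - 1| <= 2 ^+ size l * zeta &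
           `|\prod_(i <- l) (1 + z i) - 1 - \sum_(i <- l) z i| <=
             2 ^+ size l * zeta ^+ 2] by case.
elim: l => [|i l [IH1 IH2 IH3]].
  rewrite !big_nil !subrr normr1 normr0 expr0 !mul1r; split=> //.
  exact: sqr_ge0.
have e2 : 2 ^+ (size l).+1 = 2 * 2 ^+ size l :> R by rewrite exprS.
rewrite !big_cons /= !e2.
set P := \prod_(_ <- l) _ in IH1 IH2 IH3 *; set S := \sum_(_ <- l) _ in IH3 *.
have p0 : 0 <= (2 ^+ size l : R) by rewrite exprn_ge0.
split.
- rewrite normrM; apply: ler_pM => //.
  by apply: le_trans (ler_normD _ _) _; rewrite normr1; have := zz i; lra.
- have -> : (1 + z i) * P - 1 = (P - 1) + z i * P by ring.
  apply: le_trans (ler_normD _ _) _; rewrite normrM.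
  have h : `|z i| * `|P| <= zeta * 2 ^+ size l by apply: ler_pM.
  have -> : 2 * 2 ^+ size l * zeta = 2 ^+ size l * zeta + zeta * 2 ^+ size l by ring.
  exact: lerD.
- have -> : (1 + z i) * P - 1 - (z i + S) = (P - 1 - S) + z i * (P - 1) by ring.
  apply: le_trans (ler_normD _ _) _; rewrite normrM.
  have h : `|z i| * `|P - 1| <= zeta * (2 ^+ size l * zeta) by apply: ler_pM.
  have -> : 2 * 2 ^+ size l * zeta ^+ 2 =
            2 ^+ size l * zeta ^+ 2 + zeta * (2 ^+ size l * zeta) by ring.
  exact: lerD.
Qed.

(** Second moment method for the joint law of the signals: its expansion into
    products of signals has a constant term that vanishes, linear terms, and
    higher-order terms of size [tau ^ 4]. *)
Lemma push_dist_le mu nu : \sum_x mu x = \sum_x nu x ->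
  \sum_s (push mu s - push nu s) ^+ 2 <=
  2^-1 ^+ m * (\sum_k (\sum_x (mu x - nu x) * a k x) ^+ 2 +
               2 ^+ m * tau ^+ 4 * (\sum_x `|mu x - nu x|) ^+ 2).
Proof.
move=> munu; pose d x := mu x - nu x.
have d_sum : \sum_x d x = 0 by rewrite sumrB munu subrr.
have -> : \sum_s (push mu s - push nu s) ^+ 2 =
    2^-1 ^+ m * \sum_x \sum_y d x * d y * \prod_k (1 + a k x * a k y).
  have -> : \sum_s (push mu s - push nu s) ^+ 2 =
      \sum_s \sum_x \sum_y d x * d y * (signal s x * signal s y).
    apply: eq_bigr => s _; rewrite /push -sumrB expr2 big_distrlr /=.
    by apply: eq_bigr => x _; apply: eq_bigr => y _; rewrite /d; ring.
  rewrite exchange_big mulr_sumr; apply: eq_bigr => x _ /=.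
  rewrite exchange_big mulr_sumr; apply: eq_bigr => y _ /=.
  by rewrite -mulr_sumr sum_signal_signal mulrCA.
rewrite ler_pM2l; last by rewrite exprn_gt0 // invr_gt0.
have -> : \sum_k (\sum_x d x * a k x) ^+ 2 =
    \sum_x \sum_y d x * d y * \sum_k a k x * a k y.
  under [RHS]eq_bigr do under eq_bigr do rewrite mulr_sumr.
  under [RHS]eq_bigr do rewrite exchange_big.
  rewrite [RHS]exchange_big; apply: eq_bigr => k _ /=.
  rewrite expr2 big_distrlr /=.
  by apply: eq_bigr => x _; apply: eq_bigr => y _; ring.
have d1 : \sum_x \sum_y d x * d y = 0 by rewrite -big_distrlr /= d_sum mul0r.
have -> : 2 ^+ m * tau ^+ 4 * (\sum_x `|d x|) ^+ 2 =
    \sum_x \sum_y 2 ^+ m * tau ^+ 4 * (`|d x| * `|d y|).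
  rewrite expr2 big_distrlr /= mulr_sumr; apply: eq_bigr => x _.
  by rewrite mulr_sumr.
rewrite -[X in _ <= X]addr0 -[X in _ <= _ + X]d1 -!big_split; apply: ler_sum => x _ /=.
rewrite -!big_split; apply: ler_sum => y _ /=.
set P := \prod_k _; set S := \sum_k _.
have PS : `|P - 1 - S| <= 2 ^+ m * tau ^+ 4.
  have -> : tau ^+ 4 = (tau ^+ 2) ^+ 2 by rewrite -exprM.
  have -> : m = size (index_enum K) by rewrite /m cardT enumT.
  apply: prod1D_approx => [|k]; first by rewrite expr_le1 // ltW.
  by rewrite normrM expr2 ler_pM.
have h : d x * d y * (P - 1 - S) <= `|d x| * `|d y| * (2 ^+ m * tau ^+ 4).
  apply: le_trans (ler_norm _) _.
  by rewrite !normrM ler_wpM2l // mulr_ge0.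
by move: h; lra.
Qed.

Hypothesis tau_m : 19 / 20 <= (1 - tau) ^+ m.

(** The signals are weak, so that their laws under [mu] and [nu] are close in
    ratio; there the divergence is at most 3/5 of the chi-square distance. The
    constant 12/19 is 3/5 divided by the lower bound 19/20 of the law of the
    signals under [nu], relative to the uniform law. *)
Lemma KL_push_le mu nu (L : R) : (forall x, 0 <= mu x) -> (forall x, 0 < nu x) ->
    \sum_x mu x = 1 -> \sum_x nu x = 1 ->
    \sum_k (\sum_x (mu x - nu x) * a k x) ^+ 2 <= L * KL mu nu ->
  KL (push mu) (push nu) <= 12 / 19 * (L + 2 ^+ m * tau ^+ 4 * 4) * KL mu nu.
Proof.
move=> mu0 nu0 mu1 nu1 hL.
have h0 : 0 < (2^-1 : R) ^+ m by rewrite exprn_gt0 // invr_gt0.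
have p_ge s : 2^-1 ^+ m * (19 / 20) <= push nu s.
  have := @push_ge nu s (fun x => ltW (nu0 x)); rewrite nu1 mulr1.
  apply: le_trans; rewrite exprMn mulrC ler_wpM2r // ltW.
have p0 s : 0 < push nu s by apply: lt_le_trans (p_ge s); rewrite mulr_gt0.
have ratio s : 5 / 6 <= push mu s / push nu s.
  rewrite ler_pdivlMr //.
  have h1 := push_ge s mu0; have h2 := @push_le nu s (fun x => ltW (nu0 x)).
  rewrite mu1 nu1 !mulr1 in h1 h2.
  apply: le_trans h1; apply: le_trans (ler_wpM2l _ h2) _; first by rewrite divr_ge0.
  rewrite !exprMn mulrA ler_pM2r //.
  have tm : (1 + tau) ^+ m * (1 - tau) ^+ m <= 1.
    rewrite -exprMn exprn_ile1 //; have := tau1; have := tau0; nra.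
  have : (1 + tau) ^+ m <= 20 / 19.
    have q0 : 0 < (1 - tau) ^+ m by rewrite exprn_gt0 // subr_gt0.
    have q1 : 0 <= (1 + tau) ^+ m by rewrite exprn_ge0 // addr_ge0.
    have := tau_m; nra.
  by have := tau_m; nra.
apply: (@le_trans _ _ (\sum_s 3 / 5 * ((push mu s - push nu s) ^+ 2 / push nu s))).
  have -> : KL (push mu) (push nu) =
      \sum_s (push mu s * (ln (push mu s) - ln (push nu s)) - push mu s + push nu s).
    by rewrite big_split /= sumrB !sum_push mu1 nu1 subrK.
  apply: ler_sum => s _.
  have mus0 : 0 < push mu s.
    have : 0 < push mu s / push nu s by apply: lt_le_trans (ratio s); rewrite divr_gt0.
    by rewrite pmulr_lgt0 // invr_gt0.
  have := ler_wpM2l (ltW (p0 s)) (xlnx_le (ratio s)).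
  rewrite ln_div ?posrE //.
  set q := push mu s; set p := push nu s.
  have pn : p != 0 by rewrite gt_eqF // p0.
  have -> : p * (q / p * (ln q - ln p) - q / p + 1) = q * (ln q - ln p) - q + p by field.
  by have -> : p * (3 / 5 * (q / p - 1) ^+ 2) = 3 / 5 * ((q - p) ^+ 2 / p) by field.
rewrite -mulr_sumr.
have : \sum_s (push mu s - push nu s) ^+ 2 / push nu s <=
       \sum_s (push mu s - push nu s) ^+ 2 / (2^-1 ^+ m * (19 / 20)).
  apply: ler_sum => s _; rewrite ler_wpM2l ?sqr_ge0 // lef_pV2 ?p_ge ?posrE //.
rewrite -mulr_suml => hp.
have munu : \sum_x mu x = \sum_x nu x by rewrite mu1 nu1.
have dist := push_dist_le munu.
have pins := pinsker mu0 nu0 mu1 nu1.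
have : \sum_s (push mu s - push nu s) ^+ 2 / push nu s <=
   20 / 19 * (\sum_k (\sum_x (mu x - nu x) * a k x) ^+ 2 +
               2 ^+ m * tau ^+ 4 * (\sum_x `|mu x - nu x|) ^+ 2).
  apply: le_trans hp _; rewrite ler_pdivrMr ?mulr_gt0 //.
  apply: le_trans dist _; rewrite le_eqVlt; apply/orP; left; apply/eqP.
  by field.
have : 2 ^+ m * tau ^+ 4 * (\sum_x `|mu x - nu x|) ^+ 2 <=
       2 ^+ m * tau ^+ 4 * (4 * KL mu nu).
  by rewrite ler_wpM2l // mulr_ge0 // exprn_ge0.
rewrite -/m in hL *; set t := 2 ^+ m * tau ^+ 4.
have -> : 12 / 19 * (L + t * 4) * KL mu nu =
    12 / 19 * (L * KL mu nu + t * (4 * KL mu nu)) by ring.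
by move: hL; set B := \sum_k _; set C := _ * (\sum_x _) ^+ 2; lra.
Qed.

(** Chain rule: conditioning [w] on the signals splits the entropy of [f] into
    the conditional entropies and the divergence of the laws of the signals. *)
Lemma wEnt_signals_le w f (L : R) : (forall x, 0 < w x) -> (forall x, 0 <= f x) ->
    0 < \sum_x w x * f x ->
    (forall mu nu, (forall x, nu x = w x / \sum_y w y) -> (forall x, 0 <= mu x) ->
       \sum_x mu x = 1 ->
       \sum_k (\sum_x (mu x - nu x) * a k x) ^+ 2 <= L * KL mu nu) ->
  (1 - 12 / 19 * (L + 2 ^+ m * tau ^+ 4 * 4)) * wEnt w f <=
  \sum_s wEnt (fun x => w x * signal s x) f.
Proof.
move=> w0 f0 q0 hL; set q := \sum_x w x * f x in q0 *; set p := \sum_x w x.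
have wf0 x : 0 <= w x * f x by rewrite mulr_ge0 // ltW.
have p0 : 0 < p.
  rewrite lt_def sumr_ge0 ?andbT => [|x _]; last exact: ltW.
  apply: contraTneq q0 => W0; rewrite /q big1 ?ltxx // => x _.
  by rewrite (psumr_eq0P (fun j _ => ltW (w0 j)) W0) // mul0r.
pose mu x := w x * f x / q; pose nu x := w x / p.
have mu0 x : 0 <= mu x by rewrite divr_ge0 // ltW.
have nu0 x : 0 < nu x by rewrite divr_gt0.
have mu1 : \sum_x mu x = 1 by rewrite -mulr_suml divff // gt_eqF.
have nu1 : \sum_x nu x = 1 by rewrite -mulr_suml divff // gt_eqF.
have := KL_push_le mu0 nu0 mu1 nu1 (hL _ _ (fun=> erefl) mu0 mu1).
set c := 12 / 19 * _ => hKL.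
have qs s : \sum_x w x * signal s x * f x = q * push mu s.
  rewrite mulr_sumr; apply: eq_bigr => x _; rewrite /mu.
  by field; rewrite gt_eqF.
have ps s : \sum_x w x * signal s x = p * push nu s.
  by rewrite mulr_sumr; apply: eq_bigr => x _; rewrite /nu; field; rewrite gt_eqF.
have push_gt0 g s : (forall x, 0 <= g x) -> \sum_x g x = 1 -> 0 < push g s.
  move=> g0 g1; apply: lt_le_trans (push_ge s g0).
  by rewrite g1 mulr1 exprn_gt0 // divr_gt0 // subr_gt0.
have chain : \sum_s wEnt (fun x => w x * signal s x) f =
    wEnt w f - q * KL (push mu) (push nu).
  have -> : q * KL (push mu) (push nu) =
      \sum_s (q * push mu s * (ln (q * push mu s) - ln (p * push nu s))) - q * (ln q - ln p).
    have -> : q * (ln q - ln p) = \sum_s q * push mu s * (ln q - ln p).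
      by rewrite -mulr_suml -mulr_sumr sum_push mu1 mulr1.
    rewrite -sumrB mulr_sumr; apply: eq_bigr => s _.
    have pm : 0 < push mu s by exact: push_gt0.
    have pn : 0 < push nu s by apply: push_gt0 => // x; exact: ltW.
    by rewrite !lnM ?posrE //; ring.
  rewrite /wEnt -/q -/p.
  under eq_bigr do rewrite qs ps.
  rewrite sumrB exchange_big /=.
  have -> : \sum_x \sum_s w x * signal s x * f x * ln (f x) =
            \sum_x w x * f x * ln (f x).
    apply: eq_bigr => x _; rewrite -[RHS]mulr1 -(sum_signal x) mulr_sumr.
    by apply: eq_bigr => s _; ring.
  by ring.
have KLE : q * KL mu nu = wEnt w f by rewrite wEntE_KL.
rewrite chain mulrBl mul1r lerD2l lerN2 -KLE mulrCA ler_pM2l //.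
Qed.

End Signals.

(** * Peeling off the interaction *)

Section Peeling.
Variables (R : realType) (n : nat).
Variables (e : rel 'I_n) (zeta eta tau : R).
Hypothesis zeta_sqr : zeta * zeta = 1.
Hypothesis tau0 : 0 <= tau.
Hypothesis tau1 : tau < 1.
Hypothesis tau_eta : (1 - tau) * (1 + tau) = expR (- 2 * eta).
Local Notation sp := (@spin R).

(** The signal of an ordered pair of adjacent vertices: a weak noisy
    observation of their spins, correlated in the direction [zeta = 1] of a
    ferromagnetic interaction or [zeta = -1] of an antiferromagnetic one. *)
Definition edge_mean (k : 'I_n * 'I_n) (x : cube n) : R :=
  (e k.1 k.2)%:R * (tau / 2 * (sp (x k.1) + zeta * sp (x k.2))).

Let zetaE : zeta = 1 \/ zeta = -1.
Proof.
have /eqP : (zeta - 1) * (zeta + 1) = 0 by rewrite -subr_sqr expr2 zeta_sqr; ring.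
by rewrite mulf_eq0 subr_eq0 addr_eq0 => /orP[/eqP->|/eqP->]; [left|right].
Qed.

Lemma edge_mean_le k x : `|edge_mean k x| <= tau.
Proof.
rewrite /edge_mean; case: (e _ _); rewrite ?mul0r ?normr0 ?mul1r //.
rewrite /spin; case: zetaE => ->; case: (x k.1); case: (x k.2);
  apply/ler_normlP; split; have := tau0; lra.
Qed.

Let theta := ln ((1 + tau) * expR eta) / 2.

(** The sum of two spins takes three values, and its value 0 is taken exactly
    when the interaction is unfavourable. This is why the likelihood of a
    signal is exactly an external field times a pair interaction. *)
Lemma signal_factorE (b : bool) k x :
  (1 + sp b * edge_mean k x) / 2 =
  2^-1 * expR ((e k.1 k.2)%:R * (- (eta / 2) + sp b * theta * (sp (x k.1) + zeta * sp (x k.2))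
    - zeta * (eta / 2) * (sp (x k.1) * sp (x k.2)))).
Proof.
have t1 : 0 < 1 + tau by apply: ltr_wpDr.
have pos : expR (theta * 2) = (1 + tau) * expR eta.
  by rewrite /theta divfK // lnK // posrE mulr_gt0 // expR_gt0.
have neg : expR (- (theta * 2)) = (1 - tau) * expR eta.
  rewrite expRN pos; apply: (mulIf (x := (1 + tau) * expR eta)).
    by rewrite gt_eqF // mulr_gt0 // expR_gt0.
  rewrite mulVf; last by rewrite gt_eqF // mulr_gt0 // expR_gt0.
  rewrite mulrACA tau_eta -!expRD.
  by rewrite (_ : - 2 * eta + (eta + eta) = 0) ?expR0 //; ring.
have P : 1 + tau = expR (theta * 2 - eta).
  by rewrite expRD pos expRN mulfK // gt_eqF // expR_gt0.
have M : 1 - tau = expR (- (theta * 2) - eta).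
  by rewrite expRD neg expRN mulfK // gt_eqF // expR_gt0.
rewrite mulrC /edge_mean; congr (_ * _).
case: (e k.1 k.2); last by rewrite !mul0r mulr0 addr0 expR0.
rewrite !mul1r; set x1 := sp (x k.1); set x2 := sp (x k.2); set c := sp b.
pose y := c * (x1 + zeta * x2) / 2; pose q := zeta * (x1 * x2).
have -> : c * (tau / 2 * (x1 + zeta * x2)) = tau * y by rewrite /y; field.
have -> : - (eta / 2) + c * theta * (x1 + zeta * x2) - zeta * (eta / 2) * (x1 * x2) =
    theta * 2 * y - eta / 2 * (1 + q) by rewrite /y /q; field.
have : [\/ y = 1 /\ q = 1, y = -1 /\ q = 1 | y = 0 /\ q = -1].
  rewrite /y /q /c /x1 /x2 /spin; clear y q c x1 x2.
  by case: zetaE => ->; case: b; case: (x k.1); case: (x k.2);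
    first [apply: Or31; split; field | apply: Or32; split; field
          | apply: Or33; split; field].
case=> -[-> ->].
- by rewrite mulr1 P; congr expR; field.
- by rewrite mulrN1 M; congr expR; field.
- by rewrite !mulr0 subrr mulr0 subrr addr0 expR0.
Qed.

(** Multiply the likelihoods of all ordered pairs: their interaction parts weaken
    the coupling of every edge by the same amount, and their field parts add up to
    new external fields. *)
Lemma gibbs_signal (b : R) h (s : {ffun 'I_n * 'I_n -> bool}) :
  exists C h', 0 < C /\ forall x,
    gibbs e b h x * signal edge_mean s x = C * gibbs e (b - zeta * eta) h' x.
Proof.
pose c : R := 2^-1 ^+ #|{: 'I_n * 'I_n}| *
  expR (\sum_k (e k.1 k.2)%:R * (- (eta / 2)) : R).
pose h' u : R := h u + \sum_v (e u v)%:R * (sp (s (u, v)) * theta) +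
  \sum_v (e v u)%:R * (sp (s (v, u)) * theta * zeta).
exists c, h'; split.
  by rewrite mulr_gt0 ?expR_gt0 // exprn_gt0 // invr_gt0.
move=> x; rewrite /signal; under eq_bigr do rewrite signal_factorE.
rewrite big_split /= prodr_const -(big_morph expR (@expRD R) (@expR0 R)).
rewrite mulrCA /c -mulrA; congr (_ * _).
rewrite /gibbs -!expRD; congr expR.
have pairE (F : 'I_n -> 'I_n -> R) : \sum_(k : 'I_n * 'I_n) F k.1 k.2 = \sum_u \sum_v F u v.
  by rewrite pair_big.
have -> : \sum_(k : 'I_n * 'I_n) (e k.1 k.2)%:R * (- (eta / 2) +
    sp (s k) * theta * (sp (x k.1) + zeta * sp (x k.2)) -
    zeta * (eta / 2) * (sp (x k.1) * sp (x k.2))) =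
  \sum_(k : 'I_n * 'I_n) (e k.1 k.2)%:R * (- (eta / 2)) +
  (\sum_u \sum_v (e u v)%:R * (sp (s (u, v)) * theta) * sp (x u) +
   \sum_u \sum_v (e v u)%:R * (sp (s (v, u)) * theta * zeta) * sp (x u)) -
  zeta * (eta / 2) * \sum_u \sum_v (e u v)%:R * (sp (x u) * sp (x v)).
  rewrite [X in _ + (_ + X)]exchange_big /= mulr_sumr.
  under [X in _ - X]eq_bigr do rewrite mulr_sumr.
  rewrite !pair_big /= -!big_split -sumrB /=; apply: eq_bigr => -[u v] _ /=.
  by ring.
have -> : \sum_u h' u * sp (x u) = \sum_u h u * sp (x u) +
  (\sum_u \sum_v (e u v)%:R * (sp (s (u, v)) * theta) * sp (x u) +
   \sum_u \sum_v (e v u)%:R * (sp (s (v, u)) * theta * zeta) * sp (x u)).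
  rewrite -!big_split; apply: eq_bigr => u _ /=.
  by rewrite /h' !mulrDl !mulr_suml addrA.
by field.
Qed.

Variables (D : nat) (alpha : R).
Hypothesis deg : forall u, (degree e u <= D)%N.
Hypothesis esym : symmetric e.

(** Expand the squares by [(a + zeta * b)^2 <= 2 * (a^2 + b^2)]; each vertex occurs
    in at most [D] pairs as the first entry and in as many as the second. *)
Lemma sum_edge_mean_sqr_le (d : cube n -> R) :
  \sum_k (\sum_x d x * edge_mean k x) ^+ 2 <=
  D%:R * tau ^+ 2 * \sum_u (\sum_x d x * sp (x u)) ^+ 2.
Proof.
pose m u := \sum_x d x * sp (x u).
have pairE (F : 'I_n -> 'I_n -> R) : \sum_(k : 'I_n * 'I_n) F k.1 k.2 = \sum_u \sum_v F u v.
  by rewrite pair_big.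
have kE (k : 'I_n * 'I_n) : \sum_x d x * edge_mean k x =
    (e k.1 k.2)%:R * (tau / 2 * (m k.1 + zeta * m k.2)).
  rewrite /m mulr_sumr -big_split !mulr_sumr; apply: eq_bigr => x _ /=.
  by rewrite /edge_mean; ring.
under eq_bigr do rewrite kE.
rewrite (pairE (fun u v => ((e u v)%:R * (tau / 2 * (m u + zeta * m v))) ^+ 2)).
have degE u : \sum_v (e u v)%:R = (degree e u)%:R :> R.
  rewrite /degree -sum1_card natr_sum [RHS]big_mkcond /=; apply: eq_bigr => v _.
  by rewrite inE; case: (e u v).
have half : \sum_u \sum_v (e u v)%:R * m u ^+ 2 <= D%:R * \sum_u m u ^+ 2.
  rewrite mulr_sumr; apply: ler_sum => u _; rewrite -mulr_suml degE.
  by rewrite ler_wpM2r ?sqr_ge0 // ler_nat.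
have half' : \sum_u \sum_v (e u v)%:R * m v ^+ 2 <= D%:R * \sum_u m u ^+ 2.
  apply: le_trans half; rewrite exchange_big le_eqVlt; apply/orP; left; apply/eqP.
  by apply: eq_bigr => u _; apply: eq_bigr => v _; rewrite esym.
apply: (@le_trans _ _ (tau ^+ 2 / 2 * (\sum_u \sum_v (e u v)%:R * m u ^+ 2 +
                                     \sum_u \sum_v (e u v)%:R * m v ^+ 2))).
  rewrite -big_split mulr_sumr; apply: ler_sum => u _ /=.
  rewrite -big_split mulr_sumr; apply: ler_sum => v _ /=.
  case: (e u v); last by rewrite !mul0r addr0 mulr0 expr0n.
  rewrite !mul1r -subr_ge0.
  have -> : tau ^+ 2 / 2 * (m u ^+ 2 + m v ^+ 2) - (tau / 2 * (m u + zeta * m v)) ^+ 2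
          = tau ^+ 2 / 4 * (m u - zeta * m v) ^+ 2 +
            (1 - zeta * zeta) * (tau ^+ 2 / 2 * m v ^+ 2) by field.
  by rewrite zeta_sqr subrr mul0r addr0 mulr_ge0 ?sqr_ge0 // divr_ge0 ?sqr_ge0.
have t0 : 0 <= tau ^+ 2 / 2 by rewrite divr_ge0 ?sqr_ge0.
apply: le_trans (ler_wpM2l t0 (lerD half half')) _.
by rewrite le_eqVlt; apply/orP; left; apply/eqP; rewrite /m; field.
Qed.

Hypothesis alpha0 : 0 < alpha.
Variables (N : nat) (rho : R).
Hypothesis row : forall k h i, (k <= N)%N ->
  \sum_j `|influence (gibbs e (zeta * (k%:R * eta)) h) i j| <= alpha.
Hypothesis tau_m : 19 / 20 <= (1 - tau) ^+ #|{: 'I_n * 'I_n}|.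
Hypothesis rho0 : 0 < rho.
Hypothesis rho_loss : rho^-1 <=
  1 - 12 / 19 * (2 * alpha * D%:R * tau ^+ 2 + 2 ^+ #|{: 'I_n * 'I_n}| * tau ^+ 4 * 4).

(** Each round of signals conserves all but a small fraction of the entropy,
    because the displacement of the mean is controlled by the divergence;
    after [k] rounds the weight has become a product. *)
Lemma peeling k h f : (k <= N)%N -> (forall x, 0 <= f x) ->
  wEnt (gibbs e (zeta * (k%:R * eta)) h) f <=
  rho ^+ k * \sum_i locEnt (gibbs e (zeta * (k%:R * eta)) h) i f.
Proof.
move=> kN f0; elim: k kN h => [_|k IH kN] h.
  rewrite expr0 mul1r mul0r mulr0; apply: tensorization => // [x|x i j ij].
    exact: gibbs_gt0.
  rewrite /gibbs !mul0r !add0r -!expRD; congr expR.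
  rewrite -!big_split; apply: eq_bigr => u _ /=; rewrite !flipE.
  by have [->|ui] := eqVneq u i; rewrite ?(negbTE ij) // addrC.
set w := gibbs e _ h.
have w0 x : 0 < w x by exact: gibbs_gt0.
have [S_eq0|S_neq0] := eqVneq (\sum_x w x * f x) 0.
  by rewrite wEnt_null // big1 ?mulr0 // => i _; exact: locEnt_null.
have S0 : 0 < \sum_x w x * f x.
  by rewrite lt_def S_neq0 sumr_ge0 // => x _; rewrite mulr_ge0 // ltW.
have := @wEnt_signals_le R _ _ edge_mean tau tau0 tau1 edge_mean_le tau_m w f
  (2 * alpha * D%:R * tau ^+ 2) w0 f0 S0.
move=> /(_ _) loss.
have {loss} : rho^-1 * wEnt w f <= \sum_s wEnt (fun x => w x * signal edge_mean s x) f.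
  apply: le_trans (ler_wpM2r (wEnt_ge0 w0 f0) rho_loss) _; apply: loss => mu nu nuE mu0 mu1.
  have row' h' i : \sum_j `|influence (gibbs e (zeta * (k.+1%:R * eta)) h') i j| <= alpha.
    exact: row.
  have := mean_displacement_le alpha0 row' nuE mu0 mu1 => disp.
  apply: le_trans (sum_edge_mean_sqr_le _) _.
  have c0 : 0 <= D%:R * tau ^+ 2 by rewrite mulr_ge0 ?sqr_ge0.
  apply: le_trans (ler_wpM2l c0 disp) _.
  by rewrite le_eqVlt; apply/orP; left; apply/eqP; ring.
rewrite ler_pdivrMl // => /le_trans; apply.
rewrite exprS -mulrA ler_pM2l //.
have sgt s x : 0 < signal edge_mean s x.
  by apply: (@signal_gt0 _ _ _ edge_mean tau) => //; exact: edge_mean_le.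
apply: (@le_trans _ _ (rho ^+ k *
    \sum_s \sum_i locEnt (fun x => w x * signal edge_mean s x) i f)).
  rewrite mulr_sumr; apply: ler_sum => s _.
  have [C [h' [C0 wsE]]] := gibbs_signal (zeta * (k.+1%:R * eta)) h s.
  have bE : zeta * (k.+1%:R * eta) - zeta * eta = zeta * (k%:R * eta).
    by rewrite -natr1; ring.
  have -> : (fun x => w x * signal edge_mean s x) =
      (fun x => C * gibbs e (zeta * (k%:R * eta)) h' x).
    by apply/funext => x; rewrite wsE bE.
  rewrite wEnt_scale //; last by move=> x; exact: gibbs_gt0.
  under eq_bigr do rewrite locEnt_scale //.
  rewrite -mulr_sumr [X in _ <= X]mulrCA ler_pM2l //; exact/IH/ltnW.
rewrite ler_pM2l ?exprn_gt0 // exchange_big; apply: ler_sum => i _ /=.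
have ws0 s x : 0 < w x * signal edge_mean s x by rewrite mulr_gt0.
apply: le_trans (@locEnt_superadditive _ _ _
  (fun s x => w x * signal edge_mean s x) i f ws0 f0) _.
have -> : (fun x => \sum_s w x * signal edge_mean s x) = w; last by [].
by apply/funext => x; rewrite -mulr_sumr sum_signal mulr1.
Qed.

End Peeling.

(** * Approximate tensorisation of entropy in the uniqueness regime *)

Section Uniqueness.
Variable R : realType.
Implicit Types (beta delta : R) (D m N : nat).

Lemma tanh_half_mono (c c' : R) : `|c| <= `|c'| -> tanh_half c <= tanh_half c'.
Proof.
move=> cc; rewrite /tanh_half.
have E : expR `|c| <= expR `|c'| by rewrite ler_expR.
have p0 := expR_gt0 `|c|; have p1 := expR_gt0 `|c'|.
rewrite ler_pdivrMr ?addr_gt0 // mulrAC ler_pdivlMr ?addr_gt0 //.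
by lra.
Qed.

Variables (beta delta : R) (D : nat).
Hypothesis delta0 : 0 < delta.
Hypothesis delta1 : delta < 1.
Hypothesis D3 : (3 <= D)%N.
Hypothesis unique : expR `|beta| < (D%:R - delta) / (D%:R - 2 + delta).

Let D3R : 3 <= D%:R :> R.
Proof. by rewrite ler_nat. Qed.

(** The uniqueness condition of the infinite regular tree, in which every vertex
    has [D - 1] children. *)
Lemma tanh_half_unique : (D%:R - 1) * tanh_half beta <= 1 - delta.
Proof.
have d0 := delta0; have d1 := delta1; have := D3R => D3'.
have E0 := expR_gt0 `|beta|.
have := unique; rewrite ltr_pdivlMr; last by lra.
move=> h; rewrite /tanh_half mulrA ler_pdivrMr; last by lra.
by lra.
Qed.

Lemma beta_degree_le : `|beta| * D%:R <= 4.
Proof.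
have d0 := delta0; have d1 := delta1; have := D3R => D3'.
set y := (D%:R - delta) / (D%:R - 2 + delta).
have den0 : 0 < D%:R - 2 + delta by lra.
have num0 : 0 < D%:R - delta by lra.
have y1 : 1 <= y by rewrite /y ler_pdivlMr //; lra.
have y0 : 0 < y by exact: lt_le_trans y1.
have b_le : `|beta| <= ln y.
  by rewrite -[`|beta|]expRK ler_ln ?posrE ?expR_gt0 //; exact: ltW unique.
have := le_trans b_le (ln_le_half_sub_inv y1).
have -> : (y - y^-1) / 2 =
    2 * (1 - delta) * (D%:R - 1) / ((D%:R - delta) * (D%:R - 2 + delta)).
  by rewrite /y; field; rewrite !gt_eqF.
move=> h; apply: le_trans (ler_wpM2r _ h) _; first by lra.
rewrite mulrAC ler_pdivrMr ?mulr_gt0 //.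
have h1 : 0 <= (D%:R : R) * (D%:R - 3) by rewrite mulr_ge0 // subr_ge0.
have h2 : 0 <= delta * ((D%:R : R) * (D%:R - 1)) by rewrite !mulr_ge0 //; lra.
have h3 : 0 <= delta * (2 - delta) by rewrite mulr_ge0 //; lra.
lra.
Qed.

Section Graph.
Variables (n : nat) (e : rel 'I_n).
Hypothesis esym : symmetric e.
Hypothesis eirr : irreflexive e.
Hypothesis deg : forall u, (degree e u <= D)%N.

Let alpha : R := 3 / (2 * delta).

(** The neighbours of a vertex have at most [D - 1] further neighbours, so that
    [delta^-1] solves the recursion for them. The vertex itself may have [D]
    neighbours, which costs a factor [D / (D - 1) <= 3 / 2]. *)
Lemma influence_unique_le (b : R) h i : `|2 * b| <= `|beta| ->
  \sum_j `|influence (gibbs e b h) i j| <= alpha.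
Proof.
move=> bb; have d0 := delta0; have d1 := delta1; have D3' := D3R.
have t0 := tanh_half_ge0 (2 * b).
have tb := tanh_half_mono bb; have tu := tanh_half_unique.
have Dpred : D.-1.+1 = D by case: (D) D3.
have DR : D.-1%:R = D%:R - 1 :> R by rewrite -[in RHS]Dpred -natr1 addrK.
have s0 : 0 <= delta^-1 by rewrite invr_ge0 ltW.
have hD1 : (D%:R - 1) * tanh_half (2 * b) <= 1 - delta by nra.
have hs : 1 + D.-1%:R * (tanh_half (2 * b) * delta^-1) <= delta^-1.
  rewrite DR -subr_ge0.
  have -> : delta^-1 - (1 + (D%:R - 1) * (tanh_half (2 * b) * delta^-1)) =
      ((1 - delta) - (D%:R - 1) * tanh_half (2 * b)) / delta by field; rewrite gt_eqF.
  by rewrite divr_ge0 ?subr_ge0 // ltW.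
have degD u : (degree e u <= D.-1.+1)%N by rewrite Dpred.
have := @influence_row_le R n D.-1 b delta^-1 s0 hs finset.setT e h i esym eirr degD
  (fun u _ _ => finset.in_setT u) (finset.in_setT i).
move/le_trans; apply.
have tD : (degree e i)%:R * tanh_half (2 * b) <= D%:R * tanh_half (2 * b).
  by rewrite ler_wpM2r // ler_nat.
rewrite -subr_ge0.
have -> : alpha - (1 + (degree e i)%:R * (tanh_half (2 * b) * delta^-1)) =
    (3 / 2 - delta - (degree e i)%:R * tanh_half (2 * b)) / delta.
  by rewrite /alpha; field; rewrite gt_eqF.
apply: divr_ge0; last exact: ltW.
rewrite subr_ge0; apply: le_trans tD _.
nra.
Qed.

(** With [N] rounds each signal has strength [tau] with [tau ^+ 2 <= kappa / N],
    and the loss of a round is at most [18 / 19 * y / N] plus a term of order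
    [N^-2]. For large [N] this is less than the loss [1 - expR (- y / N)] that is
    allowed. *)
Lemma rounds_exist (m : nat) (kappa y L : R) :
    0 <= kappa -> 0 < y -> 0 <= L -> L * kappa <= 3 / 2 * y ->
  exists N (eta tau : R), [/\ (0 < N)%N, N%:R * eta = kappa / 2 & 0 <= eta] /\
    [/\ 0 <= tau < 1, (1 - tau) * (1 + tau) = expR (- 2 * eta),
       19 / 20 <= (1 - tau) ^+ m &
       (expR (y / N%:R))^-1 <= 1 - 12 / 19 * (L * tau ^+ 2 + 2 ^+ m * tau ^+ 4 * 4)].
Proof.
move=> k0 y0 L0 Lk.
(* the coefficient of [N^-2] in the loss *)
pose C : R := 12 / 19 * (2 ^+ m * kappa ^+ 2 * 4).
have C0 : 0 <= C by rewrite !mulr_ge0 ?exprn_ge0.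
(* the second term makes [m * tau <= 1 / 20], the last one absorbs all error terms *)
pose B : R := 1 + 400 * m%:R ^+ 2 * kappa + kappa + 19 * (y + C + C / y).
have m0 : 0 <= m%:R ^+ 2 :> R by exact: sqr_ge0.
have Cy : 0 <= C / y by rewrite divr_ge0 // ltW.
have mk : 0 <= m%:R ^+ 2 * kappa by rewrite mulr_ge0.
have B0 : 0 < B by rewrite /B; lra.
pose N := Num.bound B.
have NB : B < N%:R by exact: archi_boundP (ltW B0).
have N0 : 0 < N%:R :> R by exact: lt_trans NB.
have N_neq0 : N%:R != 0 :> R by rewrite gt_eqF.
pose eta := kappa / 2 / N%:R.
have eta0 : 0 <= eta by rewrite !divr_ge0 // ltW.
pose tau := Num.sqrt (1 - expR (- 2 * eta)).
have E1 : expR (- 2 * eta) <= 1 by rewrite -[X in _ <= X]expR0 ler_expR; lra.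
have tau0 : 0 <= tau by exact: sqrtr_ge0.
have tau_sq : tau ^+ 2 = 1 - expR (- 2 * eta) by rewrite sqr_sqrtr // subr_ge0.
have tau_le : tau ^+ 2 <= kappa / N%:R.
  rewrite tau_sq; have := expR_ge1Dx (- 2 * eta).
  have -> : kappa / N%:R = 2 * eta by rewrite /eta; field.
  lra.
have tau1 : tau < 1.
  by rewrite -(@ltr_pXn2r R 2) ?nnegrE // expr1n tau_sq; have := expR_gt0 (- 2 * eta); lra.
have mtau : m%:R * tau <= 20^-1.
  rewrite -(@ler_pXn2r R 2) ?nnegrE ?mulr_ge0 ?invr_ge0 // exprMn.
  apply: le_trans (ler_wpM2l m0 tau_le) _.
  rewrite mulrA ler_pdivrMr //.
  have := NB; rewrite /B; lra.
have bern (k : nat) : 1 - k%:R * tau <= (1 - tau) ^+ k.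
  elim: k => [|k IH]; first by rewrite mul0r subr0 expr0.
  rewrite exprS -natr1; have t1 : 0 <= 1 - tau by rewrite subr_ge0 ltW.
  apply: le_trans (ler_wpM2l t1 IH).
  have kt : 0 <= k%:R * tau * tau by rewrite !mulr_ge0.
  lra.
exists N, eta, tau; split; split=> //.
- by rewrite /eta; field.
- by rewrite tau0.
- have -> : (1 - tau) * (1 + tau) = 1 - tau ^+ 2 by ring.
  by rewrite tau_sq; ring.
- by apply: le_trans (bern m); lra.
apply: (@le_trans _ _ (1 + y / N%:R)^-1).
  rewrite lef_pV2 ?posrE ?expR_gt0 ?expR_ge1Dx //.
  by rewrite addr_gt0 // divr_gt0.
have tau4 : tau ^+ 4 <= kappa ^+ 2 / N%:R ^+ 2.
  have -> : tau ^+ 4 = (tau ^+ 2) ^+ 2 by rewrite -exprM.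
  have -> : kappa ^+ 2 / N%:R ^+ 2 = (kappa / N%:R) ^+ 2 by rewrite exprMn exprVn.
  by rewrite ler_pXn2r ?nnegrE ?sqr_ge0 // divr_ge0 // ltW.
have h1 : L * tau ^+ 2 <= 3 / 2 * y / N%:R.
  apply: le_trans (ler_wpM2l L0 tau_le) _.
  by rewrite mulrA ler_pM2r // invr_gt0.
have h2 : 12 / 19 * (2 ^+ m * tau ^+ 4 * 4) <= C / N%:R ^+ 2.
  have -> : C / N%:R ^+ 2 = 12 / 19 * (2 ^+ m * (kappa ^+ 2 / N%:R ^+ 2) * 4).
    by rewrite /C; field.
  by rewrite ler_pM2l // ler_pM2r // ler_pM2l // exprn_gt0.
apply: (@le_trans _ _ (1 - 18 / 19 * (y / N%:R) - C / N%:R ^+ 2)); last first.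
  have e1 : 3 / 2 * y / N%:R = 3 / 2 * (y / N%:R) by rewrite mulrA.
  rewrite mulrDr; lra.
rewrite -subr_ge0.
have -> : 1 - 18 / 19 * (y / N%:R) - C / N%:R ^+ 2 - (1 + y / N%:R)^-1 =
  (y * N%:R / 19 - 18 / 19 * y ^+ 2 - C - C * y / N%:R) / (N%:R * (N%:R + y)).
  by field; rewrite !gt_eqF // ?addr_gt0.
apply: divr_ge0; last by rewrite mulr_ge0 ?addr_ge0 // ltW.
have CyN : C * y / N%:R <= C * y.
  have N1 : 1 <= N%:R :> R by have := NB; rewrite /B; lra.
  by rewrite ler_pdivrMr // ler_peMr // mulr_ge0 // ltW.
have : y * B <= y * N%:R by rewrite ler_pM2l // ltW.
have yB : y * B = y + 400 * (m%:R ^+ 2 * kappa) * y + kappa * y + 19 * (y ^+ 2 + C * y + C).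
  by rewrite /B; field; rewrite gt_eqF.
rewrite {}yB.
have q1 : 0 <= m%:R ^+ 2 * kappa * y by rewrite mulr_ge0 // ltW.
have q2 : 0 <= kappa * y by rewrite mulr_ge0 // ltW.
have q3 : 0 <= y ^+ 2 by exact: sqr_ge0.
lra.
Qed.

(** The covariance bound [alpha = 3 / (2 * delta)] and [`|beta| * D <= 4] bound the
    total loss exponent by [18 / 19 * (8 / delta)] over all rounds. *)
Lemma approximate_tensorization h (f : cube n -> R) : (forall x, 0 <= f x) ->
  wEnt (gibbs e (beta / 2) h) f <=
  expR (8 / delta) * \sum_i locEnt (gibbs e (beta / 2) h) i f.
Proof.
move=> f0.
have d0 := delta0; have bD := beta_degree_le.
have alpha0 : 0 < alpha by rewrite /alpha divr_gt0 ?mulr_gt0.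
have y0 : 0 < 8 / delta by rewrite divr_gt0.
have L0 : 0 <= 2 * alpha * D%:R by rewrite mulr_ge0 // mulr_ge0 // ltW.
have Lk : 2 * alpha * D%:R * `|beta| <= 3 / 2 * (8 / delta).
  have -> : 2 * alpha * D%:R * `|beta| = 3 / delta * (`|beta| * D%:R).
    by rewrite /alpha; field; rewrite gt_eqF.
  have -> : 3 / 2 * (8 / delta) = 3 / delta * 4 by field; rewrite gt_eqF.
  by rewrite ler_wpM2l // divr_ge0 // ltW.
have [N [eta [tau [[N0 Neta eta0] [/andP[tau0 tau1] tau_eta tau_m loss]]]]] :=
  @rounds_exist #|{: 'I_n * 'I_n}| _ _ _ (normr_ge0 beta) y0 L0 Lk.
have NR : 0 < N%:R :> R by rewrite ltr0n.
pose zeta : R := if 0 <= beta then 1 else -1.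
have zz : zeta * zeta = 1 by rewrite /zeta; case: ifP; rewrite ?mulr1 // mulrNN mulr1.
have z1 : `|zeta| = 1 by rewrite /zeta; case: ifP; rewrite ?normrN normr1.
have bE : beta / 2 = zeta * (N%:R * eta).
  rewrite Neta /zeta; case: leP => b0; first by rewrite ger0_norm // mul1r.
  by rewrite ltr0_norm // mulN1r mulNr opprK.
have row k h' i : (k <= N)%N ->
    \sum_j `|influence (gibbs e (zeta * (k%:R * eta)) h') i j| <= alpha.
  move=> kN; apply: influence_unique_le.
  rewrite !normrM z1 mul1r (ger0_norm eta0) [`|2|]ger0_norm // normr_nat.
  have : k%:R * eta <= N%:R * eta by rewrite ler_wpM2r // ler_nat.
  by rewrite Neta; lra.
have := @peeling R n e zeta eta tau zz tau0 tau1 tau_eta D alpha deg esym alpha0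
  N _ row tau_m (expR_gt0 _) loss N h f (leqnn N) f0.
by rewrite -bE -expRM_natr divfK // gt_eqF.
Qed.

End Graph.

End Uniqueness.

(** * Glauber dynamics as an average of resamplings *)

Section Glauber.
Variables (R : realType) (n : nat) (nu : cube n -> R).
Hypothesis nu0 : forall x, 0 < nu x.
Implicit Types (x y : cube n) (mu g : cube n -> R) (i j : 'I_n).

Definition full (x : cube n) : supp nu := exist _ x (nu0 x).

Lemma val_full x : val (full x) = x. Proof. by []. Qed.

Lemma fullK (x : supp nu) : full (val x) = x.
Proof. exact: val_inj. Qed.

Lemma sum_supp (P : pred (supp nu)) (F : supp nu -> R) :
  \sum_(x | P x) F x = \sum_(x | P (full x)) F (full x).
Proof.
by rewrite (reindex full) //; exists val => x _; [exact: val_full|exact: fullK].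
Qed.

Lemma differ_at_one x y :
  (#|[set i | x i != y i]%SET| == 1%N) = [exists i, y == flip x i].
Proof.
apply/cards1P/existsP => -[i].
  move=> xy; exists i; apply/eqP/ffunP => j; rewrite flipE.
  have := finset.in_set1 j i; rewrite -xy inE.
  by case: (j == i); case: (x j); case: (y j).
move=> /eqP ->; exists i; apply/setP => j; rewrite !inE flipE.
by case: (j == i); case: (x j).
Qed.

Lemma flip_inj x i j : (flip x i == flip x j) = (i == j).
Proof.
apply/eqP/eqP => [/ffunP/(_ i)|->//]; rewrite !flipE eqxx.
by case: (i == j) / eqP => // _; case: (x i).
Qed.

Lemma flip_neq x i : (flip x i == x) = false.
Proof. by apply/eqP => /ffunP/(_ i); rewrite flipE eqxx; case: (x i). Qed.

(** At most one term of the sum is nonzero unless [y = x]. *)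
Lemma glauberE x y :
  glauber nu (full x) (full y) = n%:R^-1 * \sum_i
    (nu x * (y == x)%:R + nu (flip x i) * (y == flip x i)%:R) / (nu x + nu (flip x i)).
Proof.
rewrite /glauber !val_full differ_at_one; case: ifPn => [/existsP[i /eqP->]|].
  congr (_ * _); rewrite (bigD1 i) //= eqxx flip_neq mulr0 add0r mulr1.
  rewrite big1 ?addr0 // => j ji.
  by rewrite flip_inj eq_sym (negbTE ji) !mulr0 addr0 mul0r.
rewrite negb_exists => /forallP no_flip.
have -> : (full x == full y) = (y == x) by rewrite -val_eqE /= eq_sym.
case: ifPn => [/eqP ->|yx].
  congr (_ * _); apply: eq_bigr => i _.
  by rewrite ?eqxx [x == _]eq_sym flip_neq mulr1 mulr0 addr0.
rewrite big1 ?mulr0 // => i _.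
by rewrite (negbTE (no_flip i)) !mulr0 addr0 mul0r.
Qed.

Lemma kact_glauber (f : supp nu -> R) x :
  kact (glauber nu) f (full x) = n%:R^-1 * \sum_i resample nu i (f \o full) x.
Proof.
rewrite /kact sum_supp; under eq_bigr do rewrite glauberE -mulrA mulr_suml.
rewrite -mulr_sumr exchange_big; congr (_ * _); apply: eq_bigr => i _ /=.
under eq_bigr do rewrite mulrAC mulrDl.
rewrite -mulr_suml big_split /=; congr ((_ + _) / _).
  rewrite (bigD1 x) //= eqxx mulr1 big1 ?addr0 // => y yx.
  by rewrite (negbTE yx) mulr0 mul0r.
rewrite (bigD1 (flip x i)) //= eqxx mulr1 big1 ?addr0 // => y yx.
by rewrite (negbTE yx) mulr0 mul0r.
Qed.

(** The adjoint of [resample nu i]: it acts on laws instead of functions. *)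
Definition refresh i mu y : R :=
  (mu y + mu (flip y i)) * (nu y / (nu y + nu (flip y i))).

Definition glauber_step mu y : R := n%:R^-1 * \sum_i refresh i mu y.

Lemma kpush_glauber (mu : supp nu -> R) y :
  kpush (glauber nu) mu (full y) = glauber_step (mu \o full) y.
Proof.
rewrite /kpush sum_supp; under eq_bigr do rewrite glauberE mulrCA mulr_sumr.
rewrite -mulr_sumr exchange_big; congr (_ * _); apply: eq_bigr => i _ /=.
under eq_bigr do rewrite mulrDl mulrDr.
rewrite big_split /= /refresh mulrDl; congr (_ + _).
  rewrite (bigD1 y) //= eqxx mulr1 big1 ?addr0 // => x yx.
  by rewrite eq_sym (negbTE yx) mulr0 mul0r mulr0.
have flip_eq x : (y == flip x i) = (x == flip y i).
  by rewrite -(inj_eq (inv_inj (flipK i))) flipK eq_sym.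
rewrite (bigD1 (flip y i)) //= flipK eqxx mulr1 big1 ?addr0 => [|x yx].
  by rewrite [nu (flip y i) + _]addrC.
by rewrite flip_eq (negbTE yx) mulr0 mul0r mulr0.
Qed.

Lemma law_glauber t x y :
  law (glauber nu) t (full x) (full y) = iter t glauber_step (pmass R x) y.
Proof.
elim: t y => [|t IH] y.
  by rewrite /law /pmass /= -val_eqE.
rewrite /law iterS -/(law (glauber nu) t (full x)) kpush_glauber iterS.
by congr (glauber_step _ _); apply/funext => z; exact: IH.
Qed.

Lemma refresh_density i g y :
  refresh i (fun x => nu x * g x) y = nu y * resample nu i g y.
Proof. by rewrite /refresh /resample; ring. Qed.

(** Reversibility: the dynamics acts on densities as on functions. *)
Lemma glauber_step_density g y :
  glauber_step (fun x => nu x * g x) y = nu y * (n%:R^-1 * \sum_i resample nu i g y).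
Proof.
rewrite /glauber_step mulrCA; congr (_ * _); rewrite mulr_sumr.
by apply: eq_bigr => i _; exact: refresh_density.
Qed.

Hypothesis n0 : (0 < n)%N.

Let nR : 0 < n%:R :> R. Proof. by rewrite ltr0n. Qed.

Lemma sum_refresh i mu : \sum_y refresh i mu y = \sum_y mu y.
Proof.
rewrite (sum_flip_half _ i) [RHS](sum_flip_half _ i); congr (_ * _).
apply: eq_bigr => y _; rewrite /refresh flipK; field.
by rewrite gt_eqF ?addr_gt0 // gt_eqF // addr_gt0.
Qed.

Lemma refresh_ge0 i mu : (forall y, 0 <= mu y) -> forall y, 0 <= refresh i mu y.
Proof.
move=> mu0 y; rewrite mulr_ge0 ?addr_ge0 // divr_ge0 ?addr_ge0 //; exact: ltW.
Qed.

Definition glauber_act g x : R := n%:R^-1 * \sum_i resample nu i g x.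

Lemma glauber_act_ge0 g : (forall x, 0 <= g x) -> forall x, 0 <= glauber_act g x.
Proof.
move=> g0 x; rewrite mulr_ge0 ?invr_ge0 //; apply: sumr_ge0 => i _.
exact: resample_ge0.
Qed.

Variable C : R.
Hypothesis C0 : 0 < C.
Hypothesis tens : forall f, (forall x, 0 <= f x) ->
  wEnt nu f <= C * \sum_i locEnt nu i f.

(** Convexity of entropy bounds the entropy after one step by the average over
    [i] of the entropies after resampling [i]. *)
Lemma entropy_contraction f : (forall x, 0 <= f x) ->
  wEnt nu (glauber_act f) <= (1 - C^-1 / n%:R) * wEnt nu f.
Proof.
move=> f0.
have mass i : \sum_x nu x * resample nu i f x = \sum_x nu x * f x by exact: sum_resample1.
apply: le_trans (wEnt_average n0 nu0 (fun i => resample_ge0 i nu0 f0) mass) _.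
have -> : \sum_i wEnt nu (resample nu i f) = n%:R * wEnt nu f - \sum_i locEnt nu i f.
  have -> : n%:R * wEnt nu f = \sum_(i < n) wEnt nu f.
    by rewrite sumr_const card_ord mulr_natl.
  by rewrite -sumrB; apply: eq_bigr => i _; rewrite locEntE // opprB addrC subrK.
rewrite mulrBr mulrA mulVf ?gt_eqF // mul1r mulrBl mul1r lerD2l lerN2.
rewrite mulrAC mulrC ler_pM2l ?invr_gt0 //.
by rewrite ler_pdivrMl // tens.
Qed.

Hypothesis nu1 : \sum_x nu x = 1.

Lemma EntE (f : supp nu -> R) : Ent (on_supp nu) f = wEnt nu (f \o full).
Proof.
rewrite /Ent /expect /wEnt nu1 ln1 subr0 !sum_supp.
by under eq_bigr do rewrite mulrA.
Qed.

Lemma rhoLS_ge : ((C^-1 / n%:R)%:E <= rhoLS (on_supp nu) (glauber nu))%E.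
Proof.
rewrite /rhoLS.
set S := ereal_sup _.
have ub : (S <= (1 - C^-1 / n%:R)%:E)%E.
  apply: ge_ereal_sup => _ /= [f [f0 Ef] <-]; rewrite lee_fin ler_pdivrMr //.
  have e : kact (glauber nu) f \o full = glauber_act (f \o full).
    by apply/funext => x; exact: kact_glauber.
  by rewrite !EntE e; apply: entropy_contraction => x; exact: f0.
have := leeB (lexx 1%E) ub.
by rewrite -EFinB opprB addrCA subrr addr0.
Qed.

End Glauber.

(** * Mixing from entropy contraction and a warm start *)

Section Mixing.
Variables (R : realType) (n : nat) (nu : cube n -> R).
Hypothesis nu0 : forall x, 0 < nu x.
Hypothesis nu1 : \sum_x nu x = 1.
Hypothesis n0 : (0 < n)%N.
Implicit Types (x y : cube n) (mu g f : cube n -> R) (i j : 'I_n) (s : seq 'I_n) (t : nat).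

Let nR : 0 < n%:R :> R. Proof. by rewrite ltr0n. Qed.

(** ** Linearity of the dynamics *)

Lemma refreshD i mu mu' y :
  refresh nu i (fun y => mu y + mu' y) y = refresh nu i mu y + refresh nu i mu' y.
Proof. by rewrite /refresh; ring. Qed.

Lemma glauber_stepD mu mu' :
  glauber_step nu (fun y => mu y + mu' y) =
  (fun y => glauber_step nu mu y + glauber_step nu mu' y).
Proof.
apply/funext => y; rewrite /glauber_step -mulrDr -big_split; congr (_ * _).
by apply: eq_bigr => i _; exact: refreshD.
Qed.

Lemma iter_glauber_stepD t mu mu' :
  iter t (glauber_step nu) (fun y => mu y + mu' y) =
  (fun y => iter t (glauber_step nu) mu y + iter t (glauber_step nu) mu' y).
Proof. by elim: t => // t IH; rewrite iterS IH glauber_stepD. Qed.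

Lemma iter_glauber_step_ge0 t mu : (forall y, 0 <= mu y) ->
  forall y, 0 <= iter t (glauber_step nu) mu y.
Proof.
move=> mu0; elim: t => // t IH y.
rewrite iterS mulr_ge0 ?invr_ge0 //; apply: sumr_ge0 => i _.
exact: refresh_ge0.
Qed.

Lemma sum_iter_glauber_step t mu :
  \sum_y iter t (glauber_step nu) mu y = \sum_y mu y.
Proof.
elim: t => // t <-; rewrite iterS /glauber_step -mulr_sumr exchange_big /=.
under eq_bigr do rewrite sum_refresh //.
by rewrite sumr_const card_ord -[X in _ * X = _]mulr_natl mulrA mulVf ?mul1r // gt_eqF.
Qed.

Lemma iter_glauber_step_density t g :
  iter t (glauber_step nu) (fun x => nu x * g x) =
  (fun x => nu x * iter t (glauber_act nu) g x).
Proof.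
elim: t => // t IH; rewrite iterS IH.
by apply/funext => y; exact: glauber_step_density.
Qed.

(** ** Convergence from a bounded density *)

Variable c : R.
Hypothesis c1 : c <= 1.
Hypothesis contraction : forall f, (forall x, 0 <= f x) ->
  wEnt nu (glauber_act nu f) <= (1 - c / n%:R) * wEnt nu f.

Lemma iter_glauber_act_ge0 t g : (forall x, 0 <= g x) ->
  forall x, 0 <= iter t (glauber_act nu) g x.
Proof. by move=> g0; elim: t => // t IH; exact: glauber_act_ge0. Qed.

Lemma entropy_decay t g : (forall x, 0 <= g x) ->
  wEnt nu (iter t (glauber_act nu) g) <= expR (- (c * t%:R / n%:R)) * wEnt nu g.
Proof.
move=> g0; elim: t => [|t IH]; first by rewrite mulr0 mul0r oppr0 expR0 mul1r.
have cn : 0 <= 1 - c / n%:R.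
  rewrite subr_ge0 ler_pdivrMr // mul1r; apply: le_trans c1 _.
  by rewrite ler1n.
rewrite iterS; apply: le_trans (contraction (iter_glauber_act_ge0 t g0)) _.
apply: le_trans (ler_wpM2l cn IH) _; rewrite mulrA ler_wpM2r ?wEnt_ge0 //.
have -> : - (c * t.+1%:R / n%:R) = - (c / n%:R) + - (c * t%:R / n%:R).
  by rewrite -natr1; field; rewrite gt_eqF.
by rewrite expRD ler_wpM2r ?expR_ge0 // expR_ge1Dx.
Qed.

Lemma density_dist_le g (a : R) : (forall x, 0 <= g x) -> \sum_x nu x * g x = a ->
  (\sum_x `|nu x * g x - a * nu x|) ^+ 2 <= 4 * a * wEnt nu g.
Proof.
move=> g0 ga; have a0 : 0 <= a by rewrite -ga sumr_ge0 // => x _; rewrite mulr_ge0 // ltW.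
have [a_eq0|a_neq0] := eqVneq a 0.
  rewrite a_eq0 mulr0 mul0r big1 ?expr0n // => x _.
  have h : nu x * g x = 0.
    apply: (psumr_eq0P _ (etrans ga a_eq0)) => // y _.
    by rewrite mulr_ge0 // ltW.
  by rewrite h mul0r subrr normr0.
have a_gt0 : 0 < a by rewrite lt_def a_neq0.
have := @pinsker R _ (fun x => nu x * g x / a) nu.
have gn0 x : 0 <= nu x * g x / a by rewrite divr_ge0 ?mulr_ge0 // ltW.
have gn1 : \sum_x nu x * g x / a = 1 by rewrite -mulr_suml ga divff.
move=> /(_ gn0 nu0 gn1 nu1) h.
have -> : wEnt nu g = a * KL (fun x => nu x * g x / a) nu.
  rewrite wEntE_KL ?ga //; congr (_ * _); congr KL.
  by apply/funext => x; rewrite nu1 divr1.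
have -> : \sum_x `|nu x * g x - a * nu x| = a * \sum_x `|nu x * g x / a - nu x|.
  rewrite mulr_sumr; apply: eq_bigr => x _.
  rewrite -[X in X * `|_|](gtr0_norm a_gt0) -normrM; congr `|_|; field.
  by rewrite gt_eqF.
rewrite exprMn; have := ler_wpM2l (sqr_ge0 a) h.
by move/le_trans; apply; rewrite le_eqVlt; apply/orP; left; apply/eqP; ring.
Qed.

(** The mass [a] may be less than 1, which costs [- a * ln a <= 1]. *)
Lemma bounded_density_entropy_le g (a lM : R) : (forall x, 0 <= g x) ->
    \sum_x nu x * g x = a -> a <= 1 -> 0 <= lM -> (forall x, g x <= expR lM) ->
  wEnt nu g <= lM + 1.
Proof.
move=> g0 ga a1 l0 gl; rewrite /wEnt ga nu1 ln1 subr0.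
have a0 : 0 <= a by rewrite -ga sumr_ge0 // => x _; rewrite mulr_ge0 // ltW.
apply: lerD.
  apply: (@le_trans _ _ (\sum_x nu x * g x * lM)).
    apply: ler_sum => x _; apply: ler_wpM2l; first by rewrite mulr_ge0 // ltW.
    have [->|gx] := eqVneq (g x) 0; first by rewrite ln0.
    by rewrite -[X in _ <= X]expRK ler_ln ?posrE ?expR_gt0 // lt_def gx g0.
  by rewrite -mulr_suml ga ler_piMl.
have [->|a_neq0] := eqVneq a 0; first by rewrite mul0r oppr0.
have a_gt0 : 0 < a by rewrite lt_def a_neq0.
have := ler_wpM2l a0 (ln_ge_sub_inv a_gt0).
rewrite mulrBr mulr1 divff //; lra.
Qed.

(** ** The law as a mixture over update sequences *)

Fixpoint update_seqs t : seq (seq 'I_n) :=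
  if t is t'.+1 then [seq i :: s | i <- index_enum 'I_n, s <- update_seqs t']
  else [:: [::]].

Variable x0 : cube n.

Definition updated s : cube n -> R := foldr (refresh nu) (pmass R x0) s.

Lemma law_mixture t y :
  iter t (glauber_step nu) (pmass R x0) y =
  n%:R^-1 ^+ t * \sum_(s <- update_seqs t) updated s y.
Proof.
elim: t y => [|t IH] y; first by rewrite /= big_seq1 mul1r.
rewrite iterS /= big_allpairs_dep /= exprS -mulrA; congr (_ * _).
rewrite mulr_sumr; apply: eq_bigr => i _.
rewrite /refresh !IH -mulrDr -big_split -mulrA mulr_suml; congr (_ * _).
Qed.

Lemma updated_ge0 s y : 0 <= updated s y.
Proof.
elim: s y => [|i s IH] y; first by rewrite /= /pmass ler0n.
exact: refresh_ge0.
Qed.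

Lemma sum_updated s : \sum_y updated s y = 1.
Proof.
elim: s => [|i s IH]; last by rewrite /= sum_refresh.
rewrite /= /pmass (bigD1 x0) //= eqxx big1 ?addr0 // => y yx.
by rewrite (negbTE yx).
Qed.

Lemma size_update_seqs t : \sum_(s <- update_seqs t) 1 = n%:R ^+ t :> R.
Proof.
elim: t => [|t IH]; first by rewrite big_seq1 expr0.
rewrite big_allpairs_dep /=; under eq_bigr do rewrite IH.
by rewrite sumr_const card_ord -[LHS]mulr_natl exprS.
Qed.

Lemma missing_update_seqs t i :
  \sum_(s <- update_seqs t) (i \notin s)%:R = (n%:R - 1) ^+ t :> R.
Proof.
elim: t => [|t IH]; first by rewrite big_seq1 expr0.
rewrite big_allpairs_dep /= exprS -IH.
have -> : n%:R - 1 = \sum_j (i != j)%:R :> R.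
  have -> : n%:R = \sum_(j < n) 1 :> R by rewrite sumr_const card_ord.
  rewrite -[X in _ - X](@sum_delta R n (fun=> 1) i) -sumrB; apply: eq_bigr => j _.
  by rewrite mulr1 [i == j]eq_sym; case: (j == i); rewrite ?subrr ?subr0.
rewrite mulr_suml; apply: eq_bigr => j _; rewrite mulr_sumr; apply: eq_bigr => s _.
by rewrite inE negb_or -natrM mulnb.
Qed.

Definition covering s : bool := [forall i, i \in s].

Lemma noncovering_mass_le t :
  n%:R^-1 ^+ t * \sum_(s <- update_seqs t | ~~ covering s) 1 <=
  n%:R * expR (- (t%:R / n%:R)) :> R.
Proof.
have h : \sum_(s <- update_seqs t | ~~ covering s) 1 <=
    \sum_i \sum_(s <- update_seqs t) (i \notin s)%:R :> R.
  rewrite exchange_big big_mkcond; apply: ler_sum => s _ /=.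
  rewrite /covering negb_forall; case: existsP => [[i si]|_]; last first.
    by apply: sumr_ge0 => i _; exact: ler0n.
  rewrite (bigD1 i) //= si lerDl; apply: sumr_ge0 => j _; exact: ler0n.
have ni0 : 0 <= n%:R^-1 ^+ t :> R by rewrite exprn_ge0 // invr_ge0.
apply: le_trans (ler_wpM2l ni0 h) _.
under eq_bigr do rewrite missing_update_seqs.
rewrite sumr_const card_ord -[X in _ * X]mulr_natl mulrCA ler_pM2l // -exprMn.
have -> : n%:R^-1 * (n%:R - 1) = 1 - n%:R^-1 :> R by field; rewrite gt_eqF.
have -> : - (t%:R / n%:R) = (- n%:R^-1) * t%:R :> R by rewrite mulrC mulNr.
rewrite expRM_natr; apply: lerXn2r; rewrite ?nnegrE ?expR_ge0 //.
  by rewrite subr_ge0 invf_le1 // ler1n.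
exact: expR_ge1Dx.
Qed.

(** A bound on the probability of each value of a resampled coordinate that does
    not depend on the other coordinates. *)
Variable q : 'I_n -> bool -> R.
Hypothesis q_bound : forall i y, nu y / (nu y + nu (flip y i)) <= q i (y i).

Let agree (A : {set 'I_n}) (a y : cube n) : bool := [forall i in A, y i == a i].

(* Exactly one of [y] and its flip has the value [a j] at [j]. *)
Let agreeD1 (A : {set 'I_n}) a y j : j \in A ->
  (agree A a y)%:R + (agree A a (flip y j))%:R = (agree (A :\ j)%SET a y)%:R :> R.
Proof.
move=> jA.
have split_agree z : agree A a z = (z j == a j) && agree (A :\ j)%SET a z.
  apply/forall_inP/andP => [h|[zj /forall_inP h] i iA].
    split; first exact: h.
    by apply/forall_inP => i; rewrite inE => /andP[_]; exact: h.
  by have [->//|ij] := eqVneq i j; apply: h; rewrite !inE ij.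
have flip_agree : agree (A :\ j)%SET a (flip y j) = agree (A :\ j)%SET a y.
  apply: eq_forallb => i; rewrite !inE flipE.
  by have [->|] := eqVneq i j.
rewrite !split_agree flip_agree flipE eqxx.
by case: (y j); case: (a j); case: (agree _ a y); rewrite /= ?addr0 ?add0r.
Qed.

(** Once a coordinate has been updated, its conditional law given the rest is
    bounded by [q], whatever happens later to the other coordinates. *)
Lemma updated_agree_le s (A : {set 'I_n}) a : (forall i, i \in A -> i \in s) ->
  \sum_y updated s y * (agree A a y)%:R <= \prod_(i in A) q i (a i).
Proof.
elim: s A => [|j s IH] A As.
  have -> : A = finset.set0 by apply/setP => i; rewrite inE; apply/negP => /As.
  rewrite big_set0; apply: (@le_trans _ _ (\sum_y updated [::] y)).
    apply: ler_sum => y _; rewrite ler_piMr ?updated_ge0 //.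
    by case: (agree _ _ _).
  by rewrite sum_updated.
have [jA|jA] := boolP (j \in A); last first.
  have -> : \sum_y updated (j :: s) y * (agree A a y)%:R =
            \sum_y updated s y * (agree A a y)%:R.
    have inv y : agree A a (flip y j) = agree A a y.
      apply: eq_forallb => i; rewrite flipE.
      by have [->|//] := eqVneq i j; rewrite (negbTE jA).
    rewrite (sum_flip_half _ j) [RHS](sum_flip_half _ j); congr (_ * _).
    apply: eq_bigr => y _; rewrite inv -!mulrDl; congr (_ * _).
    by rewrite /= /refresh flipK; field; rewrite gt_eqF ?addr_gt0 // gt_eqF // addr_gt0.
  apply: IH => i iA; have := As i iA; rewrite inE => /predU1P[ij|//].
  by rewrite -ij iA in jA.
rewrite (big_setD1 j) //=.
have qj0 : 0 <= q j (a j).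
  have := q_bound j a; apply: le_trans.
  by rewrite divr_ge0 ?addr_ge0 // ltW.
apply: (@le_trans _ _ (q j (a j) *
    \sum_y updated s y * (agree (A :\ j)%SET a y)%:R)); last first.
  rewrite ler_wpM2l //; apply: IH => i; rewrite !inE => /andP[ij iA].
  by have := As i iA; rewrite inE (negbTE ij).
rewrite mulr_sumr.
under [X in _ <= X]eq_bigr do rewrite -(agreeD1 _ _ jA) mulrDr mulrDr.
rewrite big_split /= -[X in _ <= _ + X](sum_flip _ j) -big_split /=.
apply: ler_sum => y _; rewrite flipK.
case yA : (agree A a y); last by rewrite !mulr0 addr0.
rewrite !mulr1 -mulrDr /refresh mulrC ler_wpM2r ?addr_ge0 ?updated_ge0 //.
by have /forall_inP/(_ j jA)/eqP <- := yA; exact: q_bound.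
Qed.

Variable lM : R.
Hypothesis lM0 : 0 <= lM.
Hypothesis q_nu : forall y, \prod_i q i (y i) <= expR lM * nu y.

Lemma updated_le s y : covering s -> updated s y <= expR lM * nu y.
Proof.
move=> /forallP cov; apply: le_trans (q_nu y).
have := @updated_agree_le s finset.setT y (fun i _ => cov i).
have -> : \prod_(i in finset.setT) q i (y i) = \prod_i q i (y i).
  by apply: eq_bigl => i; rewrite inE.
apply: le_trans; rewrite (bigD1 y) //=.
have -> : agree finset.setT y y by apply/forall_inP.
by rewrite mulr1 lerDl sumr_ge0 // => z _; rewrite mulr_ge0 ?updated_ge0.
Qed.

(** Split the law at time [t0] into the part coming from the update sequences
    that cover all coordinates, which has a bounded density, and a remainder of
    small mass. The first part relaxes by entropy decay. *)
Lemma law_dist_le t0 t (eps : R) : 0 < eps ->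
    n%:R * expR (- (t0%:R / n%:R)) <= eps / 2 ->
    4 * (expR (- (c * t%:R / n%:R)) * (lM + 1)) <= (eps / 2) ^+ 2 ->
  forall A : pred (cube n),
    `| \sum_(y | A y) iter (t + t0) (glauber_step nu) (pmass R x0) y -
       \sum_(y | A y) nu y | <= eps.
Proof.
move=> e0 ht0 ht A.
pose G y : R := n%:R^-1 ^+ t0 * \sum_(s <- update_seqs t0 | covering s) updated s y.
pose B y : R := n%:R^-1 ^+ t0 * \sum_(s <- update_seqs t0 | ~~ covering s) updated s y.
have ni0 : 0 <= n%:R^-1 ^+ t0 :> R by rewrite exprn_ge0 // invr_ge0.
have split_law : iter t0 (glauber_step nu) (pmass R x0) = fun y => G y + B y.
  apply/funext => y; rewrite law_mixture -mulrDr; congr (_ * _).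
  by rewrite (bigID covering).
have G0 y : 0 <= G y.
  by rewrite mulr_ge0 // sumr_ge0 // => s _; exact: updated_ge0.
have B0 y : 0 <= B y.
  by rewrite mulr_ge0 // sumr_ge0 // => s _; exact: updated_ge0.
pose g y := G y / nu y.
have gE : G = fun y => nu y * g y.
  by apply/funext => y; rewrite /g mulrC divfK // gt_eqF.
have g0 y : 0 <= g y by rewrite divr_ge0 // ltW.
pose a := \sum_y G y; pose b := \sum_y B y.
have ab : a + b = 1.
  have := sum_iter_glauber_step t0 (pmass R x0).
  by rewrite split_law big_split /= -/a -/b => ->; exact: (sum_updated [::]).
have a0 : 0 <= a by exact: sumr_ge0.
have b0 : 0 <= b by exact: sumr_ge0.
have b_le : b <= eps / 2.
  apply: le_trans ht0; apply: le_trans (noncovering_mass_le t0).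
  rewrite /b /B -mulr_sumr exchange_big /=.
  by under eq_bigr do rewrite sum_updated.
have g_le y : g y <= expR lM.
  rewrite ler_pdivrMr // /G.
  apply: (@le_trans _ _ (n%:R^-1 ^+ t0 * \sum_(s <- update_seqs t0) expR lM * nu y)).
    rewrite ler_wpM2l // big_mkcond; apply: ler_sum => s _.
    by case: ifP => [/updated_le|_] //; rewrite mulr_ge0 ?expR_ge0 // ltW.
  have -> : \sum_(s <- update_seqs t0) expR lM * nu y = n%:R ^+ t0 * (expR lM * nu y).
    by rewrite -size_update_seqs mulr_suml; apply: eq_bigr => s _; rewrite mul1r.
  by rewrite exprVn mulKf // expf_neq0 // gt_eqF.
have ga : \sum_x nu x * g x = a by rewrite /a gE.
have a1 : a <= 1 by lra.
pose gt := iter t (glauber_act nu) g.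
have gt0 x : 0 <= gt x by exact: iter_glauber_act_ge0.
have gta : \sum_x nu x * gt x = a.
  by rewrite -ga -(sum_iter_glauber_step t (fun x => nu x * g x)) iter_glauber_step_density.
have Ent_gt : wEnt nu gt <= expR (- (c * t%:R / n%:R)) * (lM + 1).
  apply: le_trans (entropy_decay t g0) _; rewrite ler_wpM2l ?expR_ge0 //.
  exact: bounded_density_entropy_le ga a1 lM0 g_le.
have dist : \sum_x `|nu x * gt x - a * nu x| <= eps / 2.
  rewrite -(@ler_pXn2r R 2) ?nnegrE ?sumr_ge0 //; last by rewrite divr_ge0 // ltW.
  apply: le_trans (density_dist_le gt0 gta) _; apply: le_trans ht.
  rewrite -mulrA ler_pM2l //; apply: le_trans Ent_gt.
  by rewrite ler_piMl // wEnt_ge0.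
pose Bt := iter t (glauber_step nu) B.
have Bt0 y : 0 <= Bt y by exact: iter_glauber_step_ge0.
have Btb : \sum_y Bt y = b by exact: sum_iter_glauber_step.
rewrite iterD split_law iter_glauber_stepD gE iter_glauber_step_density -/gt -/Bt.
have part (F : cube n -> R) : (forall y, 0 <= F y) -> 0 <= \sum_(y | A y) F y <= \sum_y F y.
  move=> F0; rewrite sumr_ge0 //= [X in _ <= X](bigID A) /= lerDl sumr_ge0 //.
have /andP[BA0 BA1] := part Bt Bt0.
have /andP[nA0 nA1] := part nu (fun y => ltW (nu0 y)).
rewrite big_split /=.
have -> : \sum_(y | A y) nu y * gt y + \sum_(y | A y) Bt y - \sum_(y | A y) nu y =
   \sum_(y | A y) (nu y * gt y - a * nu y) + (\sum_(y | A y) Bt y - b * \sum_(y | A y) nu y).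
  rewrite sumrB -mulr_sumr.
  have -> : a = 1 - b by lra.
  by ring.
apply: le_trans (ler_normD _ _) _.
have -> : eps = eps / 2 + eps / 2 by field.
apply: lerD.
  apply: le_trans (ler_norm_sum _ _ _) _; apply: le_trans dist.
  by have /andP[] := part (fun y => `|nu y * gt y - a * nu y|) (fun y => normr_ge0 _).
apply: le_trans b_le; rewrite nu1 in nA1; rewrite Btb in BA1.
have h1 : 0 <= b * \sum_(y | A y) nu y by rewrite mulr_ge0.
have h2 : b * \sum_(y | A y) nu y <= b by rewrite ler_piMr.
by apply/ler_normlP; split; lra.
Qed.

End Mixing.

(** * The Ising model in the uniqueness regime *)

Section IsingAsGibbs.
Variables (R : realType) (n : nat) (e : rel 'I_n) (beta : R) (v : 'rV[R]_n).
Hypothesis esym : symmetric e.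
Hypothesis eirr : irreflexive e.
Local Notation sp := (@spin R).

Let h (i : 'I_n) : R := v ord0 i.

Lemma sum_ordered_pairs (F : 'I_n -> 'I_n -> R) :
    (forall i j, F i j = F j i) -> (forall i, F i i = 0) ->
  \sum_i \sum_j F i j = 2 * \sum_(i < n) \sum_(j < n | (i < j)%N) F i j.
Proof.
move=> Fsym F0.
have -> : \sum_i \sum_j F i j = \sum_(i < n) \sum_(j < n | (i < j)%N) F i j +
   \sum_(i < n) \sum_(j < n | (j < i)%N) F i j.
  rewrite -big_split; apply: eq_bigr => i _ /=.
  rewrite (bigID (fun j : 'I_n => (i < j)%N)) /=; congr (_ + _).
  rewrite [LHS](bigD1 i) /= ?ltnn // F0 add0r; apply: eq_bigl => j.
  by rewrite -leqNgt [in RHS]ltn_neqAle andbC.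
have -> : \sum_(i < n) \sum_(j < n | (j < i)%N) F i j =
          \sum_(i < n) \sum_(j < n | (i < j)%N) F i j.
  rewrite (exchange_big_dep predT) //=.
  by apply: eq_bigr => j _; apply: eq_bigr => i _; exact: Fsym.
by ring.
Qed.

Lemma ising_weightE : exists2 K : R, 0 < K &
  forall x, ising_weight e beta v x = K * gibbs e (beta / 2) h x.
Proof.
exists (expR (beta / 2 * \sum_(i < n) \sum_(j < n | (i < j)%N && e i j) 1)).
  exact: expR_gt0.
move=> x; rewrite /ising_weight /gibbs -expRD; congr expR.
have -> : \sum_i \sum_j (e i j)%:R * (sp (x i) * sp (x j)) =
    2 * \sum_(i < n) \sum_(j < n | (i < j)%N) (e i j)%:R * (sp (x i) * sp (x j)).
  apply: sum_ordered_pairs => [i j|i]; last by rewrite eirr mul0r.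
  by rewrite esym [sp (x i) * _]mulrC.
have -> : \sum_(i < n) \sum_(j < n | (i < j)%N && e i j) (x i == x j)%:R =
  2^-1 * \sum_(i < n) \sum_(j < n | (i < j)%N && e i j) 1 +
  2^-1 * \sum_(i < n) \sum_(j < n | (i < j)%N) (e i j)%:R * (sp (x i) * sp (x j)) :> R.
  rewrite -mulrDr -big_split mulr_sumr; apply: eq_bigr => i _ /=.
  rewrite !big_mkcondr -big_split mulr_sumr; apply: eq_bigr => j _ /=.
  case: (e i j); last by rewrite mul0r addr0 mulr0.
  by rewrite mul1r /spin; case: (x i); case: (x j); rewrite /=; field.
have -> : \sum_(i < n) sp (x i) * v ord0 i = \sum_i h i * sp (x i).
  by apply: eq_bigr => i _; rewrite mulrC.
by field.
Qed.

Lemma isingE x : ising e beta v x =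
  (\sum_y gibbs e (beta / 2) h y)^-1 * gibbs e (beta / 2) h x.
Proof.
have [K K0 KE] := ising_weightE; rewrite /ising KE.
under eq_bigr do rewrite KE.
rewrite -mulr_sumr; field; rewrite !gt_eqF //.
by apply: sum_gt0 => y; exact: gibbs_gt0.
Qed.

Let Z_gt0 : 0 < \sum_y gibbs e (beta / 2) h y.
Proof. by apply: sum_gt0 => y; exact: gibbs_gt0. Qed.

Lemma ising_gt0 x : 0 < ising e beta v x.
Proof. by rewrite isingE mulr_gt0 ?invr_gt0 // gibbs_gt0. Qed.

Lemma sum_ising : \sum_x ising e beta v x = 1.
Proof.
under eq_bigr do rewrite isingE.
by rewrite -mulr_sumr mulVf // gt_eqF.
Qed.

Variables (delta : R) (D : nat).
Hypothesis delta0 : 0 < delta.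
Hypothesis delta1 : delta < 1.
Hypothesis D3 : (3 <= D)%N.
Hypothesis deg : forall u, (degree e u <= D)%N.
Hypothesis unique : expR `|beta| < (D%:R - delta) / (D%:R - 2 + delta).

Lemma ising_tensorization f : (forall x, 0 <= f x) ->
  wEnt (ising e beta v) f <= expR (8 / delta) * \sum_i locEnt (ising e beta v) i f.
Proof.
move=> f0.
have -> : ising e beta v =
    fun x => (\sum_y gibbs e (beta / 2) h y)^-1 * gibbs e (beta / 2) h x.
  by apply/funext => x; exact: isingE.
rewrite wEnt_scale ?invr_gt0 //; last by move=> x; exact: gibbs_gt0.
under [X in _ <= _ * X]eq_bigr do rewrite locEnt_scale ?invr_gt0 //.
rewrite -[X in _ <= _ * X]mulr_sumr [X in _ <= X]mulrCA ler_pM2l ?invr_gt0 //.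
exact: (approximate_tensorization delta0 delta1 D3 unique esym eirr deg).
Qed.

Let eq_le (x y : R) : x = y -> x <= y.
Proof. by move=> ->. Qed.

Let bD : `|beta / 2| * D%:R <= 2.
Proof.
have := beta_degree_le delta0 delta1 D3 unique.
by rewrite normrM [`|2^-1|]ger0_norm ?invr_ge0 //; lra.
Qed.

(** The probability that a spin with external field [h i] only equals [s]. *)
Definition free_prob i (s : bool) : R := (1 + expR (- 2 * h i * sp s))^-1.

Let field_le i (s : 'I_n -> R) : (forall j, `|s j| <= 1) ->
  `|beta / 2 * \sum_j (e i j)%:R * s j| <= 2.
Proof.
move=> s1; rewrite normrM; apply: le_trans bD; rewrite ler_wpM2l //.
apply: le_trans (ler_norm_sum _ _ _) _.
apply: (@le_trans _ _ (degree e i)%:R); last by rewrite ler_nat.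
rewrite /degree -sum1_card natr_sum [X in _ <= X]big_mkcond /=; apply: ler_sum => j _.
by rewrite inE; case: (e i j); rewrite ?mul1r // mul0r normr0.
Qed.

Let sp_norm (s : bool) : `|sp s| = 1.
Proof. by case: s; rewrite /spin ?normrN normr1. Qed.

(** The neighbours shift the field on a spin by at most
    [`|beta / 2| * D <= 2], whatever their values. *)
Lemma ising_cond_le i y :
  ising e beta v y / (ising e beta v y + ising e beta v (flip y i)) <=
  expR 4 * free_prob i (y i).
Proof.
set W := gibbs e (beta / 2) h.
have W0 z : 0 < W z by exact: gibbs_gt0.
have -> : ising e beta v y / (ising e beta v y + ising e beta v (flip y i)) =
    W y / (W y + W (flip y i)).
  by rewrite !isingE -/W; field; rewrite !gt_eqF ?addr_gt0.
have Wflip : expR (- 4) * (expR (- 2 * h i * sp (y i)) * W y) <= W (flip y i).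
  rewrite /W (gibbs_frozen (beta / 2) h esym eirr (erefl (y i))).
  have fi : flip y i i = ~~ y i by rewrite flipE eqxx.
  rewrite (gibbs_frozen (beta / 2) h esym eirr fi) gibbs_frozen_flip.
  rewrite /gibbs -!expRD ler_expR.
  have -> : sp (~~ y i) = - sp (y i) by case: (y i); rewrite /spin //= opprK.
  have -> : \sum_u frozen_field e (beta / 2) h i (y i) u * sp (y u) =
      \sum_u frozen_field e (beta / 2) h i (~~ y i) u * sp (y u) +
      2 * sp (y i) * (beta / 2 * \sum_u (e i u)%:R * sp (y u)).
    rewrite !mulr_sumr -big_split; apply: eq_bigr => u _ /=.
    rewrite /frozen_field; have [->|ui] := eqVneq u i; first by rewrite eirr /=; ring.
    by case: (y i); rewrite /spin /=; ring.
  have := @field_le i (fun u => sp (y u)) (fun u => eq_le (sp_norm _)).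
  set S := beta / 2 * _ => /ler_normlP[S1 S2].
  have : sp (y i) * S <= 2 by rewrite /spin; case: (y i); lra.
  set F := \sum_u _; set Q := \sum_u _; lra.
have p0 : 0 < 1 + expR (- 2 * h i * sp (y i)) by rewrite addr_gt0 // expR_gt0.
rewrite /free_prob ler_pdivrMr ?addr_gt0 // mulrAC ler_pdivlMr //.
have E4 : 1 <= expR 4 :> R by rewrite -[X in X <= _]expR0 ler_expR.
have Wy : W y <= expR 4 * W y by rewrite ler_peMl // ltW.
rewrite mulrDr mulr1 mulrDr lerD //.
have := ler_wpM2l (expR_ge0 4) Wflip.
by rewrite [expR 4 * (expR _ * _)]mulrA -expRD subrr expR0 mul1r [_ * W y]mulrC.
Qed.

Lemma free_probE i (s : bool) :
  free_prob i s = expR (h i * sp s) / (expR (h i * sp true) + expR (h i * sp false)).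
Proof.
have E0 := expR_gt0 (h i); set E := expR (h i) in E0 *.
have E2 : 0 < E ^+ 2 + 1 by rewrite addr_gt0 // exprn_gt0.
have e2 : expR (-2 * h i) = E^-1 * E^-1 by rewrite -!expRN -expRD; congr expR; ring.
rewrite /free_prob /spin; case: s; rewrite ?mulr1 !mulrN1 !expRN -/E e2; field.
  by rewrite !gt_eqF // addrC.
by rewrite !gt_eqF // addrC.
Qed.

Let expR_sum (F : 'I_n -> R) : expR (\sum_i F i) = \prod_i expR (F i).
Proof. exact: (big_morph expR (@expRD R) (@expR0 R)). Qed.

Lemma interaction_le (y : cube n) :
  `|beta / 2 / 2 * \sum_u \sum_w (e u w)%:R * (sp (y u) * sp (y w))| <= n%:R.
Proof.
rewrite mulr_sumr; apply: le_trans (ler_norm_sum _ _ _) _.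
have -> : n%:R = \sum_(u < n) 1 :> R by rewrite sumr_const card_ord.
apply: ler_sum => u _.
have -> : beta / 2 / 2 * \sum_w (e u w)%:R * (sp (y u) * sp (y w)) =
    sp (y u) / 2 * (beta / 2 * \sum_w (e u w)%:R * sp (y w)).
  rewrite !mulr_sumr; apply: eq_bigr => w _; by ring.
have := field_le u (fun w => eq_le (sp_norm (y w))).
rewrite [in X in _ -> X]normrM [`|sp _ / 2|]normrM sp_norm.
by rewrite [`|2^-1|]ger0_norm ?invr_ge0 //; lra.
Qed.

(** The interaction energy lies between [- n] and [n], so that removing it from the
    weight and from the partition function costs [expR (2 * n)]; the factors
    [expR 4] contribute [expR (4 * n)]. *)
Lemma ising_ge_free (y : cube n) :
  \prod_i (expR 4 * free_prob i (y i)) <= expR (6 * n%:R) * ising e beta v y.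
Proof.
rewrite big_split /= prodr_const card_ord -expRM_natr.
pose P (x : cube n) := \prod_i expR (h i * sp (x i)).
have gibbsE x : gibbs e (beta / 2) h x =
    expR (beta / 2 / 2 * \sum_u \sum_w (e u w)%:R * (sp (x u) * sp (x w))) * P x.
  by rewrite /gibbs expRD expR_sum.
have P0 x : 0 < P x by apply: prodr_gt0 => i _; exact: expR_gt0.
have gibbs_le x : gibbs e (beta / 2) h x <= expR n%:R * P x.
  rewrite gibbsE ler_pM2r // ler_expR.
  by have /ler_normlP[] := interaction_le x.
have gibbs_ge x : expR (- n%:R) * P x <= gibbs e (beta / 2) h x.
  rewrite gibbsE ler_pM2r // ler_expR.
  by have /ler_normlP[h1 _] := interaction_le x; rewrite lerNl.
have SP0 : 0 < \sum_x P x by exact: sum_gt0.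
have free : \prod_i free_prob i (y i) = P y / \sum_x P x.
  have -> : \sum_x P x = \prod_i (expR (h i * sp true) + expR (h i * sp false)).
    rewrite /P -(bigA_distr_bigA (fun i b => expR (h i * sp b))).
    by apply: eq_bigr => i _; rewrite big_bool.
  by rewrite -prodf_div; apply: eq_bigr => i _; exact: free_probE.
have Z_le : \sum_x gibbs e (beta / 2) h x <= expR n%:R * \sum_x P x.
  by rewrite mulr_sumr; apply: ler_sum => x _.
rewrite free isingE.
have -> : expR (6 * n%:R) = expR (4 * n%:R) * (expR n%:R * expR n%:R) :> R.
  by rewrite -!expRD; congr expR; ring.
rewrite -!mulrA ler_pM2l ?expR_gt0 //.
set E := expR n%:R in gibbs_le gibbs_ge Z_le *; set Zs := \sum_x gibbs _ _ _ _ in Z_le *.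
have E0 : 0 < E by exact: expR_gt0.
have Zs0 : 0 < Zs by exact: Z_gt0.
have Py_le : P y <= E * gibbs e (beta / 2) h y.
  by have := gibbs_ge y; rewrite expRN -/E ler_pdivrMl.
rewrite ler_pdivrMr //; apply: (le_trans Py_le).
have -> : E * (E * (Zs^-1 * gibbs e (beta / 2) h y)) * \sum_x P x =
    E * gibbs e (beta / 2) h y * (E * (\sum_x P x) / Zs) by ring.
rewrite ler_peMr ?mulr_ge0 ?(ltW E0) ?(ltW (gibbs_gt0 _ _ _ _)) //.
by rewrite ler_pdivlMr // mul1r.
Qed.

End IsingAsGibbs.

Section Times.
Variable R : realType.

(** The first [t0.+1] steps update all coordinates with probability at least
    [1 - eps / 2], which takes a time of order [n * ln n]; afterwards the entropy
    is linear in [n], so that its exponential decay takes a time of order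
    [n * ln n / c]. *)
Lemma mixing_times (n : nat) (c eps : R) : (4 <= n)%N -> 0 < c -> 0 < eps -> eps < 1 ->
  exists t0 t : nat,
    [/\ n%:R * expR (- (t0.+1%:R / n%:R)) <= eps / 2,
        4 * (expR (- (c * t%:R / n%:R)) * (6 * n%:R + 1)) <= (eps / 2) ^+ 2 &
        (t + t0.+1)%:R <=
          (3 + ln (2 / eps) + c^-1 * (1 + ln (112 / eps ^+ 2))) * (n%:R * ln n%:R)].
Proof.
move=> n4 c0 e0 e1.
have n4R : 4 <= n%:R :> R by rewrite ler_nat.
have n0 : 0 < n%:R :> R by lra.
have ln1n : 1 <= ln n%:R :> R.
  have h2 : 1 - 2^-1 <= ln (2 : R) by apply: ln_ge_sub_inv.
  apply: (@le_trans _ _ (ln (2 ^+ 2))).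
    by rewrite lnXn // mulr2n; lra.
  by rewrite ler_ln ?posrE ?exprn_gt0 //; apply: le_trans n4R; rewrite expr2; lra.
have a0 : 0 < 2 / eps by rewrite divr_gt0.
have b0 : 0 < 112 / eps ^+ 2 by rewrite divr_gt0 // exprn_gt0.
have la0 : 0 <= ln (2 / eps) by rewrite ln_ge0 // ler_pdivlMr //; lra.
have e2 : eps ^+ 2 <= 1 by rewrite expr_le1 // ltW.
have lb0 : 0 <= ln (112 / eps ^+ 2).
  by rewrite ln_ge0 // ler_pdivlMr ?exprn_gt0 //; lra.
pose X0 : R := n%:R * (ln n%:R + ln (2 / eps)).
pose X1 : R := n%:R / c * (ln n%:R + ln (112 / eps ^+ 2)).
have X00 : 0 <= X0 by apply: mulr_ge0; lra.
have nc0 : 0 < n%:R / c by rewrite divr_gt0.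
have X10 : 0 <= X1 by apply: mulr_ge0; lra.
exists (Num.truncn X0), (Num.truncn X1).+1; split.
- apply: (@le_trans _ _ (n%:R * expR (- (ln n%:R + ln (2 / eps))))).
    rewrite ler_pM2l // ler_expR lerN2 ler_pdivlMr // mulrC -/X0.
    exact/ltW/truncnS_gt.
  rewrite expRN expRD !lnK ?posrE // le_eqVlt; apply/orP; left; apply/eqP.
  by field; rewrite !gt_eqF.
- have : expR (- (c * (Num.truncn X1).+1%:R / n%:R)) <=
      expR (- (ln n%:R + ln (112 / eps ^+ 2))).
    rewrite ler_expR lerN2 ler_pdivlMr // mulrC -ler_pdivrMl //.
    have -> : c^-1 * (n%:R * (ln n%:R + ln (112 / eps ^+ 2))) = X1 by rewrite /X1; ring.
    exact/ltW/truncnS_gt.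
  have -> : expR (- (ln n%:R + ln (112 / eps ^+ 2))) = eps ^+ 2 / (112 * n%:R).
    by rewrite expRN expRD !lnK ?posrE //; field; rewrite !gt_eqF.
  move=> h; have n6 : 0 <= 6 * n%:R + 1 :> R by lra.
  apply: (@le_trans _ _ (4 * (eps ^+ 2 / (112 * n%:R) * (7 * n%:R)))).
    rewrite ler_pM2l //; apply: ler_pM => //; lra.
  rewrite le_eqVlt; apply/orP; left; apply/eqP.
  by field; rewrite gt_eqF.
have t0_le : (Num.truncn X0)%:R <= X0 by rewrite truncn_le.
have t_le : (Num.truncn X1)%:R <= X1 by rewrite truncn_le.
have -> : ((Num.truncn X1).+1 + (Num.truncn X0).+1)%:R =
    (Num.truncn X1)%:R + 1 + ((Num.truncn X0)%:R + 1) :> R by rewrite natrD -!natr1.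
have h0 : X0 <= (1 + ln (2 / eps)) * (n%:R * ln n%:R).
  by rewrite /X0 [X in _ <= X]mulrCA ler_pM2l // [X in _ <= X]mulrDl mul1r lerD2l ler_peMr.
have h1 : X1 <= c^-1 * (1 + ln (112 / eps ^+ 2)) * (n%:R * ln n%:R).
  have -> : c^-1 * (1 + ln (112 / eps ^+ 2)) * (n%:R * ln n%:R) =
      n%:R / c * ((1 + ln (112 / eps ^+ 2)) * ln n%:R) by ring.
  by rewrite /X1 ler_pM2l // [X in _ <= X]mulrDl mul1r lerD2l ler_peMr.
have h2 : 1 <= n%:R * ln n%:R :> R.
  by rewrite -[X in X <= _]mulr1 ler_pM //; lra.
set L := n%:R * ln n%:R in h0 h1 h2 *.
set A := ln (2 / eps) in h0 *; set B := c^-1 * (1 + _) in h1 *.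
have -> : (3 + A + B) * L = (1 + A) * L + B * L + 2 * L by ring.
lra.
Qed.

End Times.

(** * The two bounds *)

Section Bounds.
Variables (R : realType) (delta : R).
Hypothesis delta0 : 0 < delta.
Hypothesis delta1 : delta < 1.
Variables (n : nat) (e : rel 'I_n) (beta : R) (v : 'rV[R]_n).
Hypothesis e_graph : simple_graph e.
Hypothesis D3 : (3 <= max_degree e)%N.
Hypothesis unique : expR `|beta| <
  ((max_degree e)%:R - delta) / ((max_degree e)%:R - 2 + delta).

Let esym : symmetric e. Proof. by case: e_graph. Qed.
Let eirr : irreflexive e. Proof. by case: e_graph. Qed.

Let deg u : (degree e u <= max_degree e)%N.
Proof. exact: (@leq_bigmax _ (fun i => #|[set j | e i j]%SET|) u). Qed.

Lemma vertices_ge4 : (4 <= n)%N.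
Proof.
have [i ni] : {i : 'I_n | max_degree e = degree e i}.
  apply: bigop.eq_bigmax; rewrite card_ord; case: (n) e D3 => // e'.
  by rewrite /max_degree big_ord0.
apply: leq_trans (_ : (degree e i).+1 <= n)%N; first by rewrite ltnS -ni.
rewrite -[X in (_ <= X)%N]card_ord -cardsT; apply: proper_card.
apply/properP; split; first by apply/fintype.subsetP => j; rewrite inE.
by exists i; rewrite ?inE ?eirr.
Qed.

Let n0 : (0 < n)%N. Proof. exact: leq_trans vertices_ge4. Qed.

Let C0 : 0 < expR (8 / delta). Proof. exact: expR_gt0. Qed.

Let nu := ising e beta v.
Let nu0 : forall x, 0 < nu x. Proof. exact: ising_gt0. Qed.
Let nu1 : \sum_x nu x = 1. Proof. exact: sum_ising. Qed.

Let tens f : (forall x, 0 <= f x) ->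
  wEnt nu f <= expR (8 / delta) * \sum_i locEnt nu i f.
Proof. exact: (ising_tensorization _ esym eirr delta0 delta1 D3 deg unique). Qed.

Lemma ising_rhoLS_ge :
  ((expR (- 8 / delta) / n%:R)%:E <= rhoLS (on_supp nu) (glauber nu))%E.
Proof.
rewrite mulNr expRN.
exact: rhoLS_ge.
Qed.

Lemma ising_tmix_le (eps : R) : 0 < eps -> eps < 1 ->
  (tmix (on_supp nu) (glauber nu) eps <=
   ((3 + ln (2 / eps) + expR (8 / delta) * (1 + ln (112 / eps ^+ 2))) *
    (n%:R * ln n%:R))%:E)%E.
Proof.
move=> e0 e1.
have c0 : 0 < (expR (8 / delta))^-1 by rewrite invr_gt0.
have c1 : (expR (8 / delta))^-1 <= 1.
  rewrite invf_le1 // -[X in X <= _]expR0 ler_expR; apply: divr_ge0 => //.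
  exact: ltW.
have [t0 [t [ht0 ht tle]]] := mixing_times vertices_ge4 c0 e0 e1.
rewrite invrK in tle.
apply: (@le_trans _ _ ((t + t0.+1)%:R)%:E); last by rewrite lee_fin.
rewrite /tmix; elim/big_ind: _ => [|a b ha hb|x _]; first exact: leNye.
  by rewrite ge_max ha.
rewrite /tmix_from; apply: ereal_inf_lbound => /=.
exists (t + t0.+1)%N; [split=> [|A]|by []]; first by rewrite addnS.
rewrite !(sum_supp nu0).
have -> : \sum_(y : cube n | full nu0 y \in A) law (glauber nu) (t + t0.+1) x (full nu0 y) =
  \sum_(y : cube n | full nu0 y \in A)
    iter (t + t0.+1) (glauber_step nu) (pmass R (val x)) y.
  by apply: eq_bigr => y _; rewrite -{1}(fullK nu0 x) law_glauber.
have lM0 : 0 <= 6 * n%:R :> R by rewrite mulr_ge0.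
exact: (law_dist_le nu0 nu1 n0 c1 (entropy_contraction nu0 n0 C0 tens) (val x)
  (q := fun i s => expR 4 * free_prob v i s)
  (ising_cond_le v esym eirr delta0 delta1 D3 deg unique) lM0
  (ising_ge_free v esym eirr delta0 delta1 D3 deg unique) e0 ht0 ht
  (fun y => full nu0 y \in A)).
Qed.

End Bounds.

Theorem corollary56 (R : realType) (delta : R)
    (hdelta0 : 0 < delta) (hdelta1 : delta < 1) :
  (forall (n : nat) (e : rel 'I_n) (beta : R) (v : 'rV[R]_n),
      simple_graph e ->
      (3 <= max_degree e)%N ->
      expR `|beta| < ((max_degree e)%:R - delta)
                     / ((max_degree e)%:R - 2 + delta) ->
      ((expR (- 8 / delta) / n%:R)%:E
         <= rhoLS (on_supp (ising e beta v))
                  (glauber (ising e beta v)))%E)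
  /\
  (forall eps : R, 0 < eps -> eps < 1 ->
     exists C : R,
       forall (n : nat) (e : rel 'I_n) (beta : R) (v : 'rV[R]_n),
         simple_graph e ->
         (3 <= max_degree e)%N ->
         expR `|beta| < ((max_degree e)%:R - delta)
                        / ((max_degree e)%:R - 2 + delta) ->
         (tmix (on_supp (ising e beta v))
               (glauber (ising e beta v)) eps
            <= (C * (n%:R * ln n%:R))%:E)%E).
Proof.
split=> [n e beta v graph D3 unique|eps e0 e1].
  exact: ising_rhoLS_ge.
exists (3 + ln (2 / eps) + expR (8 / delta) * (1 + ln (112 / eps ^+ 2))).
by move=> n e beta v graph D3 unique; exact: ising_tmix_le.
Qed.
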